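(* For $\epsilon_1,\epsilon_2\in\{\pm1\}$, $\mu_0\in(i\mathbb{R})^3$ and $s=(s_1,s_2)\in\mathbb{C}^2$ one has the equality of meromorphic functions $$G_{\mu_0}^{\epsilon_1,\epsilon_2}(s)=512\,\pi^{3(2-s_1-s_2)}\,2^{-s_1-s_2}\,G_{\mathrm{sym}}^{-\epsilon_2,-\epsilon_1}(s,-\mu_0).$$
   Context: Parameters $\mu=(\mu_1,\mu_2,\mu_3)\in(i\mathbb{R})^3$ are taken with $\mu_1+\mu_2+\mu_3=0$. Define $$\mathcal{G}_\mu^{\pm}(s)=4(2\pi)^{-3s}\prod_{j=1}^3\Gamma(s+\mu_j)\Big(\prod_{j=1}^3\cos\tfrac{\pi(s+\mu_j)}{2}\pm\frac1i\prod_{j=1}^3\sin\tfrac{\pi(s+\mu_j)}{2}\Big),$$ $$G_{\mu_0}^{\epsilon_1,\epsilon_2}(s_1,s_2)=\sum_{\substack{\eta_1,\eta_2\in\{\pm1\}\\\eta_1\eta_2=\epsilon_1\epsilon_2}}\Gamma(1-s_1-s_2)\,e^{\frac{\pi i}{2}\epsilon_2\eta_1(s_1+s_2-1)}\,\mathcal{G}_{\mu_0}^{\eta_1}(s_1)\,\mathcal{G}_{-\mu_0}^{\eta_2}(s_2)$$ (where $\mathcal G^{\pm1}=\mathcal G^{\pm}$), and $$G_{\mathrm{sym}}^{\epsilon_1,\epsilon_2}(s,\mu)=\frac1{1024\pi^{5/2}}\sum_{\substack{d_1,d_2,d_3\in\{0,1\}\\d_3\equiv d_1+d_2\,(\mathrm{mod}\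 2)}}\epsilon_1^{d_1}\epsilon_2^{d_2}(-1)^{d_1d_2}\frac{\Gamma\big(\frac{1+d_3-s_1-s_2}{2}\big)}{\Gamma\big(\frac{d_3+s_1+s_2}{2}\big)}\prod_{i=1}^3\frac{\Gamma\big(\frac{d_1+s_1-\mu_i}{2}\big)\Gamma\big(\frac{d_2+s_2+\mu_i}{2}\big)}{\Gamma\big(\frac{1+d_1-s_1+\mu_i}{2}\big)\Gamma\big(\frac{1+d_2-s_2-\mu_i}{2}\big)}.$$ *)

(* Defs.v *)
From HB Require Import structures.
From mathcomp Require Import all_boot all_order all_algebra.
From mathcomp Require Import complex.
From mathcomp Require Import all_classical all_reals all_analysis.

Set Implicit Arguments.
Unset Strict Implicit.
Unset Printing Implicit Defensive.

Import Order.TTheory GRing.Theory Num.Theory.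
Import numFieldNormedType.Exports.

Local Open Scope classical_set_scope.
Local Open Scope ring_scope.
Local Open Scope complex_scope.

(* The topology of a numFieldType is only found from a generic [K], so that the
   limit in [R[i]] for the norm topology is taken through [K := R[i]]. *)
Definition seq_lim (K : numFieldType) (u : nat -> K) : K := lim (u @ \oo).

Section ComplexFunctions.
Variable R : realType.
Implicit Types (z : R[i]).

Definition iC : R[i] := 0 +i* 1.

Definition piC : R[i] := (pi : R)%:C.

Definition cexp z : R[i] :=
  (expR (complex.Re z) * cos (complex.Im z))
  +i* (expR (complex.Re z) * sin (complex.Im z)).

Definition ccos z : R[i] := (cexp (iC * z) + cexp (- (iC * z))) / 2%:R.

Definition csin z : R[i] := (cexp (iC * z) - cexp (- (iC * z))) / (2%:R * iC).

(* [a ^ z] for a real base [a > 0] (principal branch) *)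
Definition cpow (a : R) z : R[i] := cexp (z * (ln a)%:C).

(* Gauss's form of the Gamma function,
     Gamma(z) = lim_n n! n^z / (z (z + 1) ... (z + n)),
   which converges at every z outside {0, -1, -2, ...} and there is the
   meromorphic continuation of Euler's integral.  At a pole the sequence is
   eventually 0 because 0^-1 = 0, so the total function takes the value 0 and
   (Gamma z)^-1 is the entire function 1/Gamma at every z. *)
Definition Gamma_seq z (n : nat) : R[i] :=
  (n`!)%:R * cpow n%:R z / \prod_(k < n.+1) (z + k%:R).

Definition Gamma z : R[i] := seq_lim (Gamma_seq z).

Definition Gamma_pole z : Prop := exists n : nat, z = - n%:R.

End ComplexFunctions.

Arguments iC {R}.
Arguments piC {R}.

Section GFunctions.
Variable R : realType.
Implicit Types (mu : 'rV[R[i]]_3).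

(* [calG eta mu s], for [eta] = 1 or -1, is the function with sign [eta] *)
Definition calG (eta : int) mu (s : R[i]) : R[i] :=
  4%:R * cpow (2%:R * pi) (- (3%:R * s)) * (\prod_(j < 3) Gamma (s + mu 0 j)) *
  (\prod_(j < 3) ccos (piC * (s + mu 0 j) / 2%:R)
   + eta%:~R * (iC^-1 * \prod_(j < 3) csin (piC * (s + mu 0 j) / 2%:R))).

Definition Gmu (e1 e2 : int) mu (s1 s2 : R[i]) : R[i] :=
  \sum_(eta1 <- [:: 1; -1 : int])
   \sum_(eta2 <- [:: 1; -1 : int] | eta1 * eta2 == e1 * e2)
     Gamma (1 - s1 - s2)
     * cexp (piC * iC / 2%:R * e2%:~R * eta1%:~R * (s1 + s2 - 1))
     * calG eta1 mu s1 * calG eta2 (- mu) s2.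

Definition Gsym (e1 e2 : int) (s1 s2 : R[i]) mu : R[i] :=
  (1024%:R * cpow pi (5%:R / 2%:R))^-1 *
  \sum_(d1 < 2) \sum_(d2 < 2) \sum_(d3 < 2 | (d3 == d1 + d2 %[mod 2])%N)
    e1%:~R ^+ d1 * e2%:~R ^+ d2 * (-1) ^+ (d1 * d2)
    * (Gamma ((1 + d3%:R - s1 - s2) / 2%:R) / Gamma ((d3%:R + s1 + s2) / 2%:R))
    * \prod_(k < 3)
        (Gamma ((d1%:R + s1 - mu 0 k) / 2%:R)
         * Gamma ((d2%:R + s2 + mu 0 k) / 2%:R)
         / (Gamma ((1 + d1%:R - s1 + mu 0 k) / 2%:R)
            * Gamma ((1 + d2%:R - s2 - mu 0 k) / 2%:R))).

(* The union of the polar hyperplanes of the Gamma factors: those of [Gmu] and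
   those in the numerators of [Gsym] at [- mu] have the same union.  Off this
   locally finite union both functions are holomorphic in (s1, s2). *)
Definition polar mu (s1 s2 : R[i]) : Prop :=
  [\/ Gamma_pole (1 - s1 - s2),
      exists j : 'I_3, Gamma_pole (s1 + mu 0 j)
    | exists j : 'I_3, Gamma_pole (s2 - mu 0 j)].

End GFunctions.

(* Main.v *)
Require Import Defs.
From mathcomp Require Import all_boot all_order all_algebra.
From mathcomp Require Import complex.
From mathcomp Require Import all_classical all_reals all_analysis.
From mathcomp Require Import zify ring lra.

(** Both sides are finite combinations of Gamma factors times sines and
    cosines, and the bridge between them is one identity, [Gamma_half_ratio]:
    for [d] in [{0, 1}] and [z] not a pole,
      Gamma ((d + z) / 2) / Gamma ((1 + d - z) / 2)
        = Gamma z * trig_d (pi z / 2) * 2 ^ (1 - z) * pi ^ (- 1 / 2),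
    where [trig_0] is the cosine and [trig_1] the sine.  It turns each quotient
    of Gammas in [Gsym] into a single Gamma and a trigonometric factor.  With
    [C1, S1, C2, S2] the products of the cosines and sines for [s1] and [s2],
    and [phi = pi (1 - s1 - s2) / 2], what is left is the elementary identity
      sum over eta1 * eta2 = e1 * e2 of
        e ^ (- i e2 eta1 phi) (C1 + eta1 S1 / i) (C2 + eta2 S2 / i)
      = 2 (cos phi (C1 C2 - e1 e2 S1 S2) - sin phi (e2 S1 C2 + e1 C1 S2)),
    whose four terms are those of [Gsym], and a comparison of the powers of
    [2] and [pi].

    The bridge identity is the duplication formula combined with the
    reflection formula.  Both are proved for [rGamma], the limit of the
    reciprocals of Gauss's approximants.  It is entire, vanishes exactly at
    the poles of Gamma, and satisfies [Gamma z = (rGamma z)^-1] everywhere, the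
    value [0^-1 = 0] at the poles included; so the formulas for [rGamma] carry
    no side condition.

    - Convergence ([tends_rGamma]): consecutive approximants have ratio
      [1 + O(1 / n ^ 2)], and tails of such products are close to 1
      ([normc_prod1D_le]).  The same bound shows that the limit vanishes only
      if an approximant does ([rGamma_neq0]).
    - Reflection ([rGamma_reflection]): the product of the approximants at [z]
      and [1 - z] is, up to a factor tending to 1, the partial product of
      Euler's product for the sine ([csin_prod]).  The latter is obtained from
      the factorisation of [X ^ n - 1] over the roots of unity, which factors
      [sin (n w)], by letting [n] tend to infinity under Tannery's theorem.
    - Duplication ([rGamma_duplication]): the approximants satisfy it up to an
      explicit factor whose limit is read off at [z = 1], where only
      [rGamma (1 / 2)] remains unknown; reflection gives [pi ^ (- 1 / 2)]. *)

Import Order.TTheory GRing.Theory Num.Theory.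
Import numFieldNormedType.Exports.
Local Open Scope ring_scope.
Local Open Scope complex_scope.
Import ComplexField.Normc.
Set Implicit Arguments.
Unset Strict Implicit.
Unset Printing Implicit Defensive.

(** * Limits of complex sequences *)

(** Over a generic field [K], so that the same rules for limits serve both [R]
    and [R[i]]. *)
Definition tends (K : numFieldType) (u : nat -> K) (l : K) : Prop :=
  (u @ \oo --> l)%classic.

Section Tends.
Variable K : numFieldType.
Implicit Types (u v : nat -> K) (l : K).

Lemma tends_lim u l : tends u l -> seq_lim u = l.
Proof. by move=> ul; apply: cvg_lim. Qed.

Lemma tends_unique u l l' : tends u l -> tends u l' -> l = l'.
Proof. by move=> /tends_lim <- /tends_lim <-. Qed.

Lemma tends_cst l : tends (fun=> l) l.
Proof. exact: cvg_cst. Qed.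

Lemma tendsD u v l l' :
  tends u l -> tends v l' -> tends (fun n => u n + v n) (l + l').
Proof. exact: cvgD. Qed.

Lemma tendsN u l : tends u l -> tends (fun n => - u n) (- l).
Proof. exact: cvgN. Qed.

Lemma tendsM u v l l' :
  tends u l -> tends v l' -> tends (fun n => u n * v n) (l * l').
Proof. exact: cvgM. Qed.

Lemma tendsV u l : l != 0 -> tends u l -> tends (fun n => (u n)^-1) l^-1.
Proof. exact: cvgV. Qed.

Lemma tends_norm u l : tends u l -> tends (fun n => `|u n|) `|l|.
Proof. exact: cvg_norm. Qed.

Lemma tendsX u l n : tends u l -> tends (fun k => u k ^+ n) (l ^+ n).
Proof.
move=> ul; elim: n => [|n IH]; first exact: tends_cst.
rewrite (_ : (fun k => _) = (fun k => u k * u k ^+ n)).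
  by rewrite exprS; exact: tendsM.
by apply: funext => k; rewrite exprS.
Qed.

Lemma tends_near u v l : (\forall n \near \oo%classic, u n = v n) ->
  tends u l -> tends v l.
Proof. by move=> uv; apply: cvg_trans; apply: near_eq_cvg. Qed.

Lemma tends_shift N u l : tends (fun n => u (n + N)%N) l -> tends u l.
Proof. by rewrite /tends cvg_shiftn. Qed.

Lemma tends_sub (f : nat -> nat) u l : (forall n, (n <= f n)%N) ->
  tends u l -> tends (fun n => u (f n)) l.
Proof.
move=> nf ul; apply: (@cvg_comp _ _ _ f u _ \oo%classic) => //.
move=> A [N _ NA]; exists N => // n /= Nn; apply: NA => /=.
exact: leq_trans (nf n).
Qed.

Lemma tends_continuous (f : K -> K) u l : {for l, continuous f}%classic ->
  tends u l -> tends (fun n => f (u n)) (f l).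
Proof. by move=> fl ul; exact: (cvg_comp _ _ ul fl). Qed.

Lemma tends_prod (m : nat) (u : nat -> nat -> K) (l : nat -> K) :
  (forall k, (k < m)%N -> tends (u k) (l k)) ->
  tends (fun n => \prod_(0 <= k < m) u k n) (\prod_(0 <= k < m) l k).
Proof.
elim: m => [|m IH] ul.
  rewrite big_nil (_ : (fun n => _) = fun=> 1); first exact: tends_cst.
  by apply: funext => n; rewrite big_nil.
rewrite big_nat_recr//= (_ : (fun n => _) =
   (fun n => (\prod_(0 <= k < m) u k n) * u m n)).
  apply: tendsM; [apply: IH => k km|]; apply: ul => //.
  exact: leq_trans km _.
by apply: funext => n; rewrite big_nat_recr.
Qed.

End Tends.

Arguments tends_cst {K} l.
Arguments tendsX {K u l} n _.

Section Complex.
Variable R : realType.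
Local Notation C := R[i].
Implicit Types (z w : C) (u v : nat -> C) (r x y : R).
Local Notation nc := (@normc R).

Lemma normcr z : `|z| = (nc z)%:C.
Proof. by rewrite normc_def; case: z. Qed.

Lemma normc_ge0 z : 0 <= nc z.
Proof. by case: z => a b; rewrite sqrtr_ge0. Qed.

Lemma normcB z w : nc (z - w) = nc (w - z).
Proof. by rewrite -[z - w]opprB; exact: (@normcN R). Qed.

Lemma normc_opp z : nc (- z) = nc z.
Proof. exact: (@normcN R). Qed.

Lemma normc_triangle z w : nc (z + w) <= nc z + nc w.
Proof. exact: (@le_normcD R). Qed.

Lemma normc_real r : nc r%:C = `|r|.
Proof. by rewrite /normc /= expr0n /= addr0 sqrtr_sqr. Qed.

Lemma normc_nat n : nc n%:R = n%:R.
Proof.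
by rewrite -(rmorph_nat (real_complex R)) normc_real ger0_norm ?ler0n.
Qed.

Lemma normcXn z n : nc (z ^+ n) = nc z ^+ n.
Proof. by elim: n => [|n IH]; rewrite ?normc1 // !exprS normcM IH. Qed.

Lemma normc_eq0 z : (nc z == 0) = (z == 0).
Proof. by apply/eqP/eqP => [/eq0_normc//|->]; rewrite normc0. Qed.

Lemma normc_leReIm z : nc z <= `|complex.Re z| + `|complex.Im z|.
Proof.
case: z => a b /=.
rewrite -[leRHS]ger0_norm ?addr_ge0// -[leRHS]sqrtr_sqr ler_wsqrtr//.
rewrite sqrrD !real_normK ?num_real//.
by rewrite -addrA lerD2l lerDr mulrn_wge0 ?mulr_ge0.
Qed.

Lemma normc_geRe z : `|complex.Re z| <= nc z.
Proof.
by case: z => a b /=; rewrite -sqrtr_sqr ler_wsqrtr// lerDl sqr_ge0.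
Qed.

Lemma normc_geIm z : `|complex.Im z| <= nc z.
Proof.
by case: z => a b /=; rewrite -sqrtr_sqr ler_wsqrtr// lerDr sqr_ge0.
Qed.

(** The definition quantifies over positive complex radii; this reduces complex
    limits to estimates between real numbers. *)
Lemma tends_dist u l : tends u l <-> tends (fun n => nc (u n - l)) 0.
Proof.
split=> ul.
- apply/cvgrPdist_lt => e e0.
  have /cvgrPdist_lt /(_ e%:C) : tends u l by [].
  rewrite ltcR => /(_ e0); apply: filterS => n.
  rewrite normcr ltcR sub0r normrN ger0_norm ?normc_ge0//.
  by rewrite normcB.
- apply/cvgrPdist_lt => e; rewrite ltcE => /andP[/eqP /= ime e0].
  have := ul; rewrite /tends => /cvgrPdist_lt /(_ _ e0).
  apply: filterS => n.
  rewrite sub0r normrN ger0_norm ?normc_ge0// normcr ltcE /= ime eqxx /=.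
  by rewrite normcB.
Qed.

Lemma tends_le (u : nat -> C) l (b : nat -> R) : tends b 0 ->
  (\forall n \near \oo%classic, nc (u n - l) <= b n) -> tends u l.
Proof.
move=> b0 ub; apply/tends_dist.
apply: (@squeeze_cvgr _ _ _ _ (fun=> 0) b) => //; last exact: cvg_cst.
by apply: filterS ub => n ->; rewrite normc_ge0.
Qed.

Lemma tends_ReIm u l : tends (fun n => complex.Re (u n)) (complex.Re l) ->
  tends (fun n => complex.Im (u n)) (complex.Im l) -> tends u l.
Proof.
move=> Re Im.
have h1 := tendsD Re (tends_cst (- complex.Re l)).
have h2 := tendsD Im (tends_cst (- complex.Im l)).
rewrite subrr in h1; rewrite subrr in h2.
have := tendsD (tends_norm h1) (tends_norm h2).
rewrite normr0 addr0 => n0.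
apply: (tends_le n0); apply: nearW => n; apply: (le_trans (normc_leReIm _)).
by case: (u n) => a b; case: l {Re Im h1 h2 n0}.
Qed.

Lemma tends_real (u : nat -> R) l :
  tends u l -> tends (fun n => (u n)%:C) l%:C.
Proof. by move=> ul; apply: tends_ReIm => //=; exact: tends_cst. Qed.

Lemma tends_Re u l : tends u l ->
  tends (fun n => complex.Re (u n)) (complex.Re l).
Proof.
move=> /tends_dist ul; apply/cvgrPdist_lt => e e0.
have /cvgrPdist_lt/(_ e e0) := ul; apply: filterS => n.
rewrite sub0r normrN ger0_norm ?normc_ge0// => /(le_lt_trans _); apply.
by rewrite normcB; apply: le_trans (normc_geRe _); case: l {ul} => a b;
  case: (u n).
Qed.

Lemma tends_Im u l : tends u l ->
  tends (fun n => complex.Im (u n)) (complex.Im l).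
Proof.
move=> /tends_dist ul; apply/cvgrPdist_lt => e e0.
have /cvgrPdist_lt/(_ e e0) := ul; apply: filterS => n.
rewrite sub0r normrN ger0_norm ?normc_ge0// => /(le_lt_trans _); apply.
by rewrite normcB; apply: le_trans (normc_geIm _); case: l {ul} => a b;
  case: (u n).
Qed.

Lemma tends_normc u l : tends u l -> tends (fun n => nc (u n)) (nc l).
Proof.
move=> ul; have : tends (fun n => `|u n|) `|l| by exact: tends_norm.
by move=> /tends_Re; rewrite normcr.
Qed.

Lemma tends_leq u v l l' c : tends u l -> tends v l' ->
  (\forall n \near \oo%classic, nc (u n) <= nc (v n) * c) -> nc l <= nc l' * c.
Proof.
move=> /tends_normc ul /tends_normc vl uv.
have vc := tendsM vl (tends_cst c).
exact: (ler_cvg_to ul vc).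
Qed.

Lemma tends_invn (c : R) : tends (fun n => c / n.+1%:R) 0.
Proof.
rewrite -(mulr0 c); apply: tendsM; first exact: tends_cst.
exact: cvg_harmonic.
Qed.

(** Completeness of [R[i]] in the quantitative form produced by the product
    estimates: the real and imaginary parts are Cauchy in [R]. *)
Lemma cauchy_tends u (c : R) N :
  (forall n m, (N <= n <= m)%N -> nc (u m - u n) <= c / n%:R) ->
  exists l, tends u l.
Proof.
move=> uc.
have real_case (f : nat -> R) :
    (forall n m, (N <= n <= m)%N -> `|f m - f n| <= c / n%:R) ->
    exists l, tends f l.
  move=> fc; suff : cvg (f @ \oo)%classic by move=> /cvg_ex.
  apply: R_complete; apply: cauchy_exP => e e0.
  have /cvgrPdist_lt/(_ _ e0) [M _ HM] := tends_invn c.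
  pose p := maxn N M.
  exists (f p.+1), p.+1 => // n /= pn; rewrite /ball /=.
  have := HM p (leq_maxr _ _); rewrite /= sub0r normrN => h.
  rewrite distrC; apply: le_lt_trans (fc _ _ _) _.
    by rewrite pn andbT ltnW// ltnS leq_maxl.
  exact: le_lt_trans (ler_norm _) h.
have [a ua] : exists a, tends (fun n => complex.Re (u n)) a.
  apply: real_case => n m /uc; apply: le_trans.
  by apply: le_trans (normc_geRe _); case: (u n) => ? ?; case: (u m).
have [b ub] : exists a, tends (fun n => complex.Im (u n)) a.
  apply: real_case => n m /uc; apply: le_trans.
  by apply: le_trans (normc_geIm _); case: (u n) => ? ?; case: (u m).
by exists (a +i* b); apply: tends_ReIm.
Qed.

End Complex.

(** * Elementary estimates for real functions *)

Section RealEstimates.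
Variable R : realType.
Implicit Types x : R.

Lemma sin_mvt x : 0 <= x -> exists2 c, 0 <= c <= x & sin x = x * cos c.
Proof.
move=> x0.
have [|c] := @MVT_segment R sin cos 0 x x0 (fun y _ => is_derive_sin y).
  by apply: continuous_subspaceT => y; exact: continuous_sin.
by rewrite in_itv /= => cx; rewrite sin0 !subr0 => ->; exists c;
  rewrite 1?mulrC.
Qed.

Lemma normr_sin_le x : `|sin x| <= `|x|.
Proof.
wlog x0 : x / 0 <= x => [h|].
  by case: (leP 0 x) => [/h//|/ltW]; rewrite -oppr_ge0 => /h;
    rewrite sinN !normrN.
have [c _ ->] := sin_mvt x0.
by rewrite normrM ler_piMr// cos_max.
Qed.

Lemma normr_cosB1_le x : `|cos x - 1| <= x ^+ 2.
Proof.
have -> : cos x = 1 - sin (x / 2) ^+ 2 *+ 2.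
  have {1}-> : x = (x / 2) *+ 2 by rewrite -mulr_natr divfK ?pnatr_eq0.
  rewrite cos_mulr2n cos2sin2; ring.
have := normr_sin_le (x / 2).
rewrite -ler_sqr ?nnegrE// !real_normK ?num_real//.
have := sqr_ge0 (sin (x / 2)); have := sqr_ge0 x => h1 h2 h3.
rewrite ler_norml; apply/andP; split; nra.
Qed.

Lemma normr_sinB_le x : `|sin x - x| <= `|x| ^+ 3.
Proof.
wlog x0 : x / 0 <= x => [h|].
  case: (leP 0 x) => [/h//|/ltW]; rewrite -oppr_ge0 => /h.
  by rewrite sinN -opprD !normrN.
have [c /andP[c0 cx] ->] := sin_mvt x0.
rewrite -[X in _ - X]mulr1 -mulrBr normrM exprS ler_wpM2l//.
apply: le_trans (normr_cosB1_le c) _.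
by rewrite ler_sqr ?nnegrE// (le_trans cx) ?ler_norm.
Qed.

(** The half-angle formula turns the mean value bound [sin y >= y * cos y]
    into [sin x = 2 sin (x/2) cos (x/2) >= x * cos (x/2) ^ 2 >= x / 2]. *)
Lemma sin_ge_half x : 0 <= x <= pi / 2 -> x / 2 <= sin x.
Proof.
move=> /andP[x0 xpi].
have pi0 : 0 < pi :> R := pi_gt0 R.
have x20 : 0 <= x / 2 by lra.
have [c /andP[c0 cx] sE] := sin_mvt x20.
have xE : x = (x / 2) *+ 2 by rewrite -mulr_natr divfK ?pnatr_eq0.
have cc : cos (x / 2) <= cos c.
  have [->//|cNx] := eqVneq c (x / 2).
  rewrite ltW// ltr_cos ?in_itv/= ?lt_neqAle ?cNx//; lra.
have cp : 0 <= cos (x / 2) by apply: cos_ge0_pihalf; apply/andP; split; lra.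
have : 0 <= cos x by apply: cos_ge0_pihalf; apply/andP; split; lra.
rewrite {1}xE cos_mulr2n => c1.
have pq : 1 / 2 <= cos (x / 2) * cos c by nra.
have -> : sin x = (x / 2) * (cos (x / 2) * cos c * 2).
  by rewrite {1}xE sin_mulr2n sE; ring.
nra.
Qed.

(** The upper bound comes from [expR x <= (1 - x)^-1], the lower bound
    [1 + - x <= expR (- x)] inverted. *)
Lemma normr_expR_le x : `|x| <= 1 / 2 -> `|expR x - 1 - x| <= 2 * x ^+ 2.
Proof.
rewrite ler_norml => /andP[x1 x2].
have h1 := expR_ge1Dx x; have h2 := expR_ge1Dx (- x).
have h3 := expRxMexpNx_1 x; have h4 := expR_gt0 x.
have h5 : expR x * (1 - x) <= 1.
  by rewrite -[leRHS]h3; apply: ler_wpM2l h2; exact: ltW.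
rewrite ler_norml; apply/andP; split; first by have := sqr_ge0 x; lra.
have h6 : expR x <= 1 + x + 2 * x ^+ 2.
  have : 0 < 1 - x by lra.
  have := sqr_ge0 x => h7 h8.
  have : (expR x - (1 + x + 2 * x ^+ 2)) * (1 - x) <= 0 by nra.
  by rewrite pmulr_lle0 // subr_le0.
lra.
Qed.

End RealEstimates.

(** * Complex exponential, sine and cosine *)

Section ComplexExp.
Variable R : realType.
Local Notation C := R[i].
Implicit Types (z w : C).
Local Notation nc := (@normc R).
Local Notation iC := (@iC R).

Lemma iC2 : iC * iC = -1.
Proof. by apply/eqP; rewrite eq_complex /= !mulr0 !mul0r !mulr1 sub0r addr0
  oppr0 !eqxx. Qed.

Lemma iC_neq0 : iC != 0.
Proof. by rewrite eq_complex /= oner_eq0 andbF. Qed.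

Lemma iCV : iC^-1 = - iC.
Proof. by apply: (mulfI iC_neq0); rewrite mulfV ?iC_neq0// mulrN iC2 opprK. Qed.

Lemma natC_neq0 n : n.+1%:R != 0 :> C.
Proof. by rewrite pnatr_eq0. Qed.

Lemma normc_iC : nc iC = 1.
Proof. by rewrite /normc /= expr0n expr1n /= add0r sqrtr1. Qed.

Lemma cexp0 : cexp (0 : C) = 1.
Proof. by rewrite /cexp /= expR0 cos0 sin0 mulr1 mulr0. Qed.

Lemma cexpD z w : cexp (z + w) = cexp z * cexp w.
Proof.
case: z => a b; case: w => c d; rewrite /cexp /= expRD cosD sinD.
by apply/eqP; rewrite eq_complex /=; apply/andP; split; apply/eqP; ring.
Qed.

Lemma cexpNK z : cexp z * cexp (- z) = 1.
Proof. by rewrite -cexpD subrr cexp0. Qed.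

Lemma cexp_neq0 z : cexp z != 0.
Proof.
by apply/eqP => z0; have := cexpNK z; rewrite z0 mul0r => /eqP;
  rewrite eq_sym oner_eq0.
Qed.

Lemma cexpN z : cexp (- z) = (cexp z)^-1.
Proof. by apply: (mulfI (cexp_neq0 z)); rewrite cexpNK mulfV ?cexp_neq0. Qed.

Lemma cexp_natM n z : cexp (n%:R * z) = cexp z ^+ n.
Proof.
elim: n => [|n IH]; first by rewrite mul0r cexp0.
by rewrite -natr1 mulrDl mul1r cexpD IH exprSr.
Qed.

Lemma cexp_real (x : R) : cexp x%:C = (expR x)%:C.
Proof. by rewrite /cexp /= cos0 sin0 mulr1 mulr0. Qed.

Lemma cexp_iC (x : R) : cexp (iC * x%:C) = cos x +i* sin x.
Proof. by rewrite /cexp /= !mul0r !mul1r subrr expR0 add0r !mul1r. Qed.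

Lemma csin_real (x : R) : csin x%:C = (sin x)%:C.
Proof.
rewrite /csin -mulrN -rmorphN/= !cexp_iC cosN sinN.
apply: (canLR (mulfK _)); first by rewrite mulf_neq0 ?iC_neq0 ?natC_neq0.
apply/eqP; rewrite eq_complex /=; apply/andP; split; apply/eqP; ring.
Qed.

Lemma csinN z : csin (- z) = - csin z.
Proof. by rewrite /csin !mulrN opprK -[RHS]mulNr opprB. Qed.

Lemma iC2neq0 : 2%:R * iC != 0.
Proof. by rewrite mulf_neq0 ?iC_neq0 ?natC_neq0. Qed.

(** Factorises [X - Y] when [X] and [Y] are exponentials; applied to the roots
    of unity it turns linear factors of [X ^ n - 1] into sines. *)
Lemma cexpB_csin z w :
  cexp (2%:R * (iC * z)) - cexp (2%:R * (iC * w)) =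
  cexp (iC * (z + w)) * (2%:R * iC * csin (z - w)).
Proof.
rewrite /csin [2%:R * iC * _]mulrC divfK ?iC2neq0//.
rewrite mulrBr -!cexpD; congr (cexp _ - cexp _); ring.
Qed.

Lemma csinD_csinB z w :
  csin (z + w) * csin (z - w) = csin z ^+ 2 - csin w ^+ 2.
Proof.
have n0 := iC2neq0.
rewrite /csin !mulrDr !mulrN !opprD !opprK !cexpD !cexpN.
have a0 := cexp_neq0 (iC * z); have b0 := cexp_neq0 (iC * w).
move: (cexp _) (cexp _) a0 b0 => a b a0 b0.
field; rewrite a0 b0 /=.
by apply/andP; split; [exact: iC_neq0|].
Qed.

Lemma csinDpihalf z : csin (z + piC / 2%:R) = ccos z.
Proof.
have e : cexp (iC * (piC / 2%:R)) = iC.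
  rewrite /piC -(rmorph_nat (real_complex R)) -fmorphV -rmorphM cexp_iC.
  by rewrite cos_pihalf sin_pihalf.
rewrite /csin /ccos mulrDr opprD !cexpD cexpN e cexpN e iCV.
have a0 := cexp_neq0 (iC * z).
field.
by rewrite a0 iC_neq0.
Qed.

Lemma normc_cexp_le z : nc z <= 1 / 2 -> nc (cexp z - 1 - z) <= 7 * nc z ^+ 2.
Proof.
move=> z12; apply: le_trans (normc_leReIm _) _.
have az := normc_geRe z; have bz := normc_geIm z.
have z0 := normc_ge0 z.
move: (nc z) z12 az bz z0 => r; case: z => a b /= r12 ar br r0.
have h1 := normr_expR_le (le_trans ar r12).
have h2 := normr_cosB1_le b; have h3 := normr_sinB_le b.
have h4 := normr_sin_le b; have h5 := cos_max b.
have a2 : a ^+ 2 <= r ^+ 2 by rewrite -real_normK ?num_real// ler_sqr ?nnegrE.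
have b2 : b ^+ 2 <= r ^+ 2 by rewrite -real_normK ?num_real// ler_sqr ?nnegrE.
have r2 : r ^+ 2 <= r / 2 by nra.
have b3 : `|b| ^+ 3 <= r ^+ 2.
  rewrite exprSr real_normK ?num_real//.
  by apply: le_trans (ler_pM _ _ b2 br) _ => //; rewrite ?sqr_ge0//; nra.
have -> : expR a * cos b - 1 - a =
  (expR a - 1 - a) * cos b + (1 + a) * (cos b - 1) by ring.
have -> : expR a * sin b - 0 - b = (expR a - 1) * sin b + (sin b - b) by ring.
have e1 : `|expR a - 1| <= 2 * r.
  rewrite -[expR a - 1](subrK a).
  apply: le_trans (ler_normD _ _) _; nra.
have e2 : `|1 + a| <= 3 / 2.
  by apply: le_trans (ler_normD _ _) _; rewrite normr1; lra.
have n1 : `|(expR a - 1 - a) * cos b| <= 2 * r ^+ 2.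
  rewrite normrM -[leRHS]mulr1; apply: ler_pM => //; nra.
have n2 : `|(1 + a) * (cos b - 1)| <= 3 / 2 * r ^+ 2.
  rewrite normrM; apply: ler_pM => //; nra.
have n3 : `|(expR a - 1) * sin b| <= 2 * r ^+ 2.
  rewrite normrM (_ : 2 * r ^+ 2 = (2 * r) * r); last by ring.
  by apply: ler_pM => //; nra.
have t1 := ler_normD ((expR a - 1 - a) * cos b) ((1 + a) * (cos b - 1)).
have t2 := ler_normD ((expR a - 1) * sin b) (sin b - b).
have := sqr_ge0 r; lra.
Qed.

Lemma normc_csin_le z : nc z <= 1 / 2 -> nc (csin z - z) <= 7 * nc z ^+ 2.
Proof.
move=> z12.
have -> : csin z - z = ((cexp (iC * z) - 1 - iC * z)
     - (cexp (- (iC * z)) - 1 - - (iC * z))) / (2%:R * iC).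
  by rewrite /csin; field; rewrite iC_neq0.
have nz : nc (iC * z) = nc z by rewrite normcM normc_iC mul1r.
have nzN : nc (- (iC * z)) = nc z by rewrite normc_opp.
have h1 : nc (cexp (iC * z) - 1 - iC * z) <= 7 * nc z ^+ 2.
  by rewrite -nz; apply: normc_cexp_le; rewrite nz.
have h2 : nc (cexp (- (iC * z)) - 1 - - (iC * z)) <= 7 * nc z ^+ 2.
  by rewrite -nzN; apply: normc_cexp_le; rewrite nzN.
rewrite normcM normcV normcM normc_iC normc_nat mulr1.
rewrite ler_pdivrMr//; apply: le_trans (normc_triangle _ _) _.
by rewrite normc_opp; lra.
Qed.

End ComplexExp.

(** * Infinite products *)

Section Products.
Variable R : realType.
Local Notation C := R[i].
Local Notation nc := (@normc R).

Lemma tends_divn (c : R) : tends (fun n => c / n%:R) 0.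
Proof.
apply: (@tends_shift _ 1); rewrite (_ : (fun n => _) = fun n => c / n.+1%:R).
  exact: tends_invn.
by apply: funext => n; rewrite addn1.
Qed.

Lemma near_leqn (x : R) : \forall n \near \oo%classic, (x <= n%:R) && (0 < n)%N.
Proof.
have [N _ HN] := nbhs_infty_ger x; exists (maxn N 1) => // n /=.
by rewrite geq_max => /andP[/HN /= -> ->].
Qed.

(** The sum of [B / (k + 1) ^ 2] telescopes below [B * (1 / K - 1 / m)]; as long
    as this is at most [1 / 2] the partial products stay below 2, and each new
    factor moves the product by at most twice its own deviation from 1. *)
Lemma normc_prod1D_le (a : nat -> C) (B : R) K m : 0 <= B ->
  (0 < K <= m)%N -> 2 * B <= K%:R ->
  (forall k, (K <= k < m)%N -> nc (a k) <= B / k.+1%:R ^+ 2) ->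
  nc (\prod_(K <= k < m) (1 + a k) - 1) <= 2 * B / K%:R.
Proof.
move=> B0 /andP[K0 Km] BK aB.
have Kp : 0 < K%:R :> R by rewrite ltr0n.
suff : nc (\prod_(K <= k < m) (1 + a k) - 1) <= 2 * B * (K%:R^-1 - m%:R^-1).
  move=> /le_trans; apply; rewrite ler_wpM2l ?mulr_ge0// lerBlDr lerDl.
  by rewrite invr_ge0.
elim: m Km aB => [|m IH]; first by rewrite leqNgt K0.
rewrite leq_eqVlt => /orP[/eqP <- _|].
  by rewrite big_geq// !subrr normc0 mulr0.
rewrite ltnS => Km aB; rewrite big_nat_recr//=.
have mp : 0 < m%:R :> R by rewrite ltr0n (leq_trans K0).
move: (IH Km) => {}IH.
have {}IH : nc (\prod_(K <= k < m) (1 + a k) - 1) <= 2 * B *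
  (K%:R^-1 - m%:R^-1).
  apply: IH => k /andP[Kk km]; apply: aB; rewrite Kk/=; exact: ltnW.
have {aB}aB : nc (a m) <= B / m.+1%:R ^+ 2 by apply: aB; rewrite Km /=.
move: (\prod_(K <= k < m) _) IH => P IH.
have -> : P * (1 + a m) - 1 = (P - 1) + P * a m by ring.
apply: le_trans (normc_triangle _ _) _; rewrite normcM.
have P2 : nc P <= 2.
  rewrite -[P](subrK 1); apply: le_trans (normc_triangle _ _) _; rewrite normc1.
  have : 2 * B * (K%:R^-1 - m%:R^-1) <= 1.
    have : 2 * B / K%:R <= 1 by rewrite ler_pdivrMr// mul1r.
    have : 0 <= B / m%:R by rewrite divr_ge0.
    nra.
  by move: IH; lra.
have : nc P * nc (a m) <= 2 * (B / m.+1%:R ^+ 2).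
  by apply: ler_pM => //; exact: normc_ge0.
have : B / m.+1%:R ^+ 2 <= B * (m%:R^-1 - m.+1%:R^-1).
  rewrite ler_wpM2l//.
  have -> : m%:R^-1 - m.+1%:R^-1 = (m%:R * m.+1%:R)^-1 :> R.
    by rewrite -natr1; field; rewrite ?gt_eqF// ?addr_gt0.
  rewrite lef_pV2 ?posrE ?exprn_gt0 ?mulr_gt0 ?ltr0n ?(leq_trans K0 Km)//.
  by rewrite expr2 ler_wpM2r// ler_nat.
move: IH.
generalize (nc P * nc (a m)) (B / m.+1%:R ^+ 2) (nc (P - 1)).
generalize (K%:R^-1 : R) (m%:R^-1 : R) (m.+1%:R^-1 : R).
by move=> p q r x y t; lra.
Qed.

(** Tannery's theorem for products.  The tail estimate compares the full product
    [P_m] with its first [K] factors uniformly in [m]; letting [m] tend to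
    infinity gives [nc (S - Q) <= nc Q * (2 * B / K)] for the limit [Q] of these
    factors, and this also bounds [Q] in terms of [S] alone. *)
Lemma tends_prod_tannery (a : nat -> nat -> C) (b : nat -> C) (S : C) (B : R) :
  0 <= B ->
  tends (fun m => \prod_(0 <= k < m) (1 + a m k)) S ->
  (forall k, tends (fun m => a m k) (b k)) ->
  (\forall m \near \oo%classic, forall k, (k < m)%N ->
     nc (a m k) <= B / k.+1%:R ^+ 2) ->
  tends (fun K => \prod_(0 <= k < K) (1 + b k)) S.
Proof.
move=> B0 PS ab aB.
apply: (tends_le (tends_divn (4 * B * nc S))).
apply: filterS (near_leqn (4 * B)) => K /andP[BK K0].
have Kp : 0 < K%:R :> R by rewrite ltr0n.
have QK : tends (fun m =>
  \prod_(0 <= k < K) (1 + a m k)) (\prod_(0 <= k < K) (1 + b k)).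
  exact: (@tends_prod C K (fun k m => 1 + a m k) (fun k => 1 + b k)
            (fun k _ => tendsD (tends_cst 1) (ab k))).
move: (\prod_(0 <= k < K) (1 + b k)) QK => Q QK.
have SQ : nc (S - Q) <= nc Q * (2 * B / K%:R).
  apply: (tends_leq (tendsD PS (tendsN QK)) QK).
  near=> m.
  have Km : (K <= m)%N by near: m; exists K.
  rewrite (big_cat_nat (leq0n K) Km)/=.
  have -> (x y : C) : x * y - x = x * (y - 1) by ring.
  rewrite normcM ler_wpM2l ?normc_ge0//.
  apply: normc_prod1D_le => //; first by rewrite K0.
    by move: B0 BK; lra.
  move=> k /andP[_ km]; move: k km; near: m; exact: aB.
have hB : 2 * B / K%:R <= 1 / 2.
  by rewrite ler_pdivrMr//; move: BK; lra.
have Q2 : nc Q <= 2 * nc S.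
  have : nc Q <= nc S + nc (S - Q).
    by have := normc_triangle S (Q - S); rewrite (addrC S) subrK (normcB Q).
  have : nc Q * (2 * B / K%:R) <= nc Q * (1 / 2).
    by rewrite ler_wpM2l ?normc_ge0.
  by move: SQ; lra.
rewrite normcB; apply: le_trans SQ _.
have -> : 4 * B * nc S / K%:R = 2 * nc S * (2 * B / K%:R) by field;
  rewrite gt_eqF.
by rewrite ler_wpM2r// divr_ge0// mulr_ge0.
Unshelve. all: by end_near. Qed.

End Products.

(** * Euler's product for the sine *)

Section SineProduct.
Variable R : realType.
Local Notation C := R[i].
Implicit Types (z w : C).
Local Notation nc := (@normc R).
Local Notation iC := (@iC R).

Definition root_angle n (j : nat) : R := pi * j%:R / n%:R.
Definition zeta n : C := cexp (2%:R * (iC * (root_angle n 1)%:C)).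

Lemma root_angleE n j : (root_angle n j)%:C = j%:R * (root_angle n 1)%:C.
Proof.
rewrite -(rmorph_nat (real_complex R)) -rmorphM/= /root_angle; congr (_%:C).
by ring.
Qed.

Lemma zetaX n j : zeta n ^+ j = cexp (2%:R * (iC * (root_angle n j)%:C)).
Proof. by rewrite -cexp_natM [in RHS]root_angleE; congr cexp; ring. Qed.

Lemma zetaE n j : zeta n ^+ j =
  (1 - 2 * sin (root_angle n j) ^+ 2) +i* (2 * sin (root_angle n j) *
    cos (root_angle n j)).
Proof.
rewrite zetaX; set x := root_angle n j.
have -> : 2%:R * (iC * x%:C) = iC * (x *+ 2)%:C.
  by rewrite rmorphMn /=; ring.
rewrite cexp_iC cos_mulr2n sin_mulr2n cos2sin2.
by congr (_ +i* _); ring.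
Qed.

Lemma zeta_prim n : (0 < n)%N -> n.-primitive_root (zeta n).
Proof.
move=> n0; apply/andP; split => //; apply/forallP => i.
have np : 0 < n%:R :> R by rewrite ltr0n.
have pi0 : 0 < pi :> R := pi_gt0 R.
rewrite unity_rootE zetaE; apply/eqP.
have [->|iNn] := eqVneq i.+1 n.
  apply/eqP; have -> : root_angle n n = pi by rewrite /root_angle mulfK ?gt_eqF.
  by rewrite sinpi expr0n !mulr0 mul0r subr0.
apply/negbTE/eqP => -[/eqP + _].
rewrite subr_eq addrC -subr_eq subrr eq_sym mulf_eq0 pnatr_eq0 /= sqrf_eq0.
apply/negP; rewrite gt_eqF// sin_gt0_pi// /root_angle.
rewrite divr_gt0 ?mulr_gt0 ?ltr0n//= ltr_pdivrMr// ltr_pM2l// ltr_nat.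
by rewrite ltn_neqAle iNn ltn_ord.
Qed.

Lemma prod_zeta n (x : C) : (0 < n)%N ->
  \prod_(1 <= i < n) (x - zeta n ^+ i) = \sum_(i < n) x ^+ i.
Proof.
move=> n0; have := factor_Xn_sub_1 (zeta_prim n0).
rewrite big_ltn// expr0 subrX1 => /(mulfI _) h.
have {h}: \prod_(1 <= i < n) ('X - (zeta n ^+ i)%:P) =
  \sum_(i < n) 'X^i :> {poly C}.
  by apply: h; rewrite polyXsubC_eq0.
move=> /(congr1 (horner^~ x)); rewrite horner_prod horner_sum.
under eq_bigr do rewrite hornerXsubC.
by under [RHS]eq_bigr do rewrite hornerXn.
Qed.

Lemma big_nat_pairs (F : nat -> C) m :
  \prod_(1 <= i < m.*2.+1) F i =
  \prod_(0 <= k < m) (F k.+1 * F (m.*2.+1 - k.+1)%N).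
Proof.
rewrite big_split/= (@big_cat_nat _ _ _ m.+1)//=; last first.
  by rewrite ltnS -addnn leq_addr.
rewrite big_add1 /=; congr (_ * _).
rewrite -{1}[m.+1]add0n big_addn -addnn subSS addKn [RHS]big_nat_rev /= add0n.
by apply: eq_big_nat => k /andP[_ km]; congr F; lia.
Qed.

(** For odd [n = 2 m + 1] the roots of unity other than 1 come in conjugate
    pairs, and the two linear factors of a pair combine into a difference of
    squared sines. *)
Lemma zeta_pair m k (w : C) : (k < m)%N ->
  (cexp (2%:R * (iC * w)) - zeta m.*2.+1 ^+ k.+1) *
  (cexp (2%:R * (iC * w)) - zeta m.*2.+1 ^+ (m.*2.+1 - k.+1)) =
  cexp (2%:R * (iC * w)) *
  (4%:R * (csin (root_angle m.*2.+1 k.+1)%:C ^+ 2 - csin w ^+ 2)).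
Proof.
set n := m.*2.+1 => km; set v := (root_angle n k.+1)%:C.
have zN : zeta n ^+ (n - k.+1) = cexp (2%:R * (iC * (- v))).
  have z0 : zeta n ^+ k.+1 != 0 by exact/expf_neq0/cexp_neq0.
  rewrite !mulrN cexpN -zetaX; apply: (mulIf z0).
  rewrite -exprD subnK; last by rewrite /n; lia.
  by rewrite (prim_expr_order (zeta_prim _))// mulVf.
rewrite zN zetaX !cexpB_csin opprK -/v.
have -> : 4%:R * (csin v ^+ 2 - csin w ^+ 2) =
    (2%:R * iC) ^+ 2 * (csin (w + v) * csin (w - v)).
  by rewrite csinD_csinB (exprMn 2 2%:R iC) (expr2 iC) iC2; ring.
have -> : cexp (2%:R * (iC * w)) = cexp (iC * (w + v)) * cexp (iC * (w - v)).
  by rewrite -cexpD; congr cexp; ring.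
ring.
Qed.

(** The pairing at [X = 1], where [1 + X + ... + X ^ (n - 1)] equals [n]. *)
Lemma prod_csin_root_angle m :
  \prod_(0 <= k < m) (4%:R * csin (root_angle m.*2.+1 k.+1)%:C ^+ 2)
  = m.*2.+1%:R :> C.
Proof.
have := @prod_zeta m.*2.+1 (cexp (2%:R * (iC * 0))) isT.
rewrite big_nat_pairs; under eq_big_nat => k /andP[_ km] do rewrite zeta_pair//.
rewrite !mulr0 cexp0.
under [X in _ = X]eq_bigr do rewrite expr1n.
rewrite sumr_const card_ord => <-; apply: eq_bigr => k _.
by rewrite /csin mulr0 oppr0 cexp0 subrr mul0r expr0n subr0 mul1r.
Qed.

Lemma csin_root_angle_neq0 m k : (k < m)%N ->
  csin (root_angle m.*2.+1 k.+1)%:C != 0 :> C.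
Proof.
move=> km; apply/eqP => s0.
have := prod_csin_root_angle m; rewrite (@big_cat_nat _ _ _ k)//= ?(ltnW km)//.
rewrite (big_ltn km) s0 expr0n /= !mulr0 !mul0r mulr0 => /eqP.
by rewrite eq_sym pnatr_eq0.
Qed.

(** Comparing the factorisation of [X ^ n - 1] at [X = cexp (2 i w)] with its
    value at [w = 0], which provides the constant [n]. *)
Lemma csin_odd_mul m (w : C) : csin w != 0 ->
  csin (m.*2.+1%:R * w) = m.*2.+1%:R * csin w *
  \prod_(0 <= k < m) (1 - csin w ^+ 2 / csin (root_angle m.*2.+1 k.+1)%:C ^+ 2).
Proof.
move=> w0.
have H : csin (m.*2.+1%:R * w) = csin w * \prod_(0 <= k < m)
    (4%:R * (csin (root_angle m.*2.+1 k.+1)%:C ^+ 2 - csin w ^+ 2)).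
  have := @prod_zeta m.*2.+1 (cexp (2%:R * (iC * w))) isT.
  rewrite big_nat_pairs;
    under eq_big_nat => k /andP[_ km] do rewrite zeta_pair//.
  rewrite big_split/= prodr_const_nat subn0.
  move=> /(congr1 (fun t => (cexp (2%:R * (iC * w)) - 1) * t)).
  rewrite -subrX1 -!cexp_natM.
  have cB z : cexp (2%:R * (iC * z)) - 1 = cexp (iC * z) * (2%:R * iC * csin z).
    by have := cexpB_csin z 0; rewrite !mulr0 cexp0 addr0 subr0.
  have -> : m.*2.+1%:R * (2%:R * (iC * w)) =
    2%:R * (iC * (m.*2.+1%:R * w)) by ring.
  rewrite !cB.
  set P := \prod_(_ <= _ < _) _.
  have -> : cexp (iC * (m.*2.+1%:R * w)) =
    cexp (iC * w) * cexp (m%:R * (2%:R * (iC * w))).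
    by rewrite -cexpD; congr cexp; rewrite -natr1 -muln2 natrM; ring.
  have e1 := cexp_neq0 (iC * w);
    have e2 := cexp_neq0 (m%:R * (2%:R * (iC * w))).
  have e3 := iC_neq0 R.
  move: (cexp _) (cexp _) e1 e2 => a b a0 b0 h.
  have ba : b * a * (2%:R * iC) != 0 by rewrite !mulf_neq0// iC2neq0.
  apply: (mulfI ba); rewrite -[LHS]mulrA -h; ring.
rewrite H [m.*2.+1%:R * csin w]mulrC -[RHS]mulrA; congr (_ * _).
rewrite -(prod_csin_root_angle m) -big_split/=;
  apply: eq_big_nat => k /andP[_ km].
by have := csin_root_angle_neq0 km => s0; field.
Qed.

Lemma tends_csin_scaled w : tends (fun n => n%:R * csin (w / n%:R)) w.
Proof.
apply: (tends_le (tends_divn (7 * nc w ^+ 2))).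
apply: filterS (near_leqn (2 * nc w)) => n /andP[wn n0].
have np : 0 < n%:R :> R by rewrite ltr0n.
have nC : n%:R != 0 :> C by rewrite pnatr_eq0 -lt0n.
have -> : n%:R * csin (w / n%:R) - w = n%:R * (csin (w / n%:R) - w / n%:R).
  by field.
have nw : nc (w / n%:R) = nc w / n%:R by rewrite normcM normcV normc_nat.
rewrite normcM normc_nat.
have : nc (csin (w / n%:R) - w / n%:R) <= 7 * nc (w / n%:R) ^+ 2.
  by apply: normc_csin_le; rewrite nw ler_pdivrMr//; move: wn; lra.
move=> /(ler_wpM2l (ltW np)) /le_trans; apply; rewrite nw.
by rewrite le_eqVlt; apply/orP; left; apply/eqP; field; rewrite gt_eqF.
Qed.

(** Euler's product, by letting [m] tend to infinity in [csin_odd_mul]. *)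
Theorem csin_prod w : w != 0 ->
  tends (fun K => \prod_(0 <= k < K) (1 - w ^+ 2 / (piC * k.+1%:R) ^+ 2))
        (csin w / w).
Proof.
move=> w0.
have f_odd z : tends (fun m => m.*2.+1%:R * csin (z / m.*2.+1%:R)) z.
  have odd_ge n : (n <= n.*2.+1)%N by lia.
  exact: (tends_sub odd_ge (@tends_csin_scaled z)).
pose a m k := - (csin (w / m.*2.+1%:R) ^+ 2 /
                 csin (root_angle m.*2.+1 k.+1)%:C ^+ 2).
have raE m k : (root_angle m k)%:C = piC * k%:R / m%:R.
  by rewrite /root_angle rmorphM fmorphV rmorphM !rmorph_nat.
have pi0 : piC != 0 :> C by rewrite eq_complex /= gt_eqF// pi_gt0.
have B0 : 0 <= (nc w + 1) ^+ 2 by exact: sqr_ge0.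
apply: (tends_prod_tannery (a := a) B0).
- have fw : tends (fun m => (m.*2.+1%:R * csin (w / m.*2.+1%:R))^-1) w^-1.
    exact: tendsV.
  apply: tends_near (tendsM (tends_cst (csin w)) fw).
  have /tends_normc/cvgrPdist_lt/(_ (nc w)) := f_odd w.
  rewrite lt_neqAle eq_sym normc_eq0 w0 normc_ge0 => /(_ isT).
  apply: filterS => m fm.
  have s0 : csin (w / m.*2.+1%:R) != 0.
    apply/eqP => s0; move: fm; rewrite s0 mulr0 normc0 subr0.
    by rewrite ger0_norm ?normc_ge0// ltxx.
  have n0 : m.*2.+1%:R != 0 :> C by rewrite pnatr_eq0.
  rewrite -{1}[w](mulfVK n0) [_ * m.*2.+1%:R]mulrC csin_odd_mul//.
  by rewrite mulrAC mulfV ?mul1r// mulf_neq0.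
- move=> k; apply: tendsN; rewrite /a.
  have k0 : piC * k.+1%:R != 0 :> C by rewrite mulf_neq0// pnatr_eq0.
  have := tendsM (tendsX 2 (f_odd w)) (tendsV (expf_neq0 2 k0) (tendsX 2 (f_odd
    (piC * k.+1%:R)))).
  congr tends; apply: funext => m.
  rewrite raE; move: (csin _) (csin _) => p q;
    rewrite !exprMn invfM mulrACA mulfV ?mul1r//.
have /tends_normc/cvgrPdist_lt/(_ 1 ltr01) := f_odd w.
apply: filterS => m fm k km.
have n0 : 0 < m.*2.+1%:R :> R by rewrite ltr0n.
have wb : m.*2.+1%:R * nc (csin (w / m.*2.+1%:R)) <= nc w + 1.
  move: fm; rewrite normcM normc_nat => /ltW; rewrite ler_norml => /andP[+ _].
  by lra.
(* The angle [pi (k + 1) / (2 m + 1)] is below [pi / 2], so its sine is at least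
   half of it, and [pi / 2 >= 1]. *)
have sb : k.+1%:R <= m.*2.+1%:R * sin (root_angle m.*2.+1 k.+1).
  have := @sin_ge_half R (root_angle m.*2.+1 k.+1).
  have p2 := pi_ge2 R; have kp : 0 < k.+1%:R :> R by rewrite ltr0n.
  have -> : 0 <= root_angle m.*2.+1 k.+1 <= pi / 2.
    rewrite /root_angle divr_ge0 ?mulr_ge0 ?pi_ge0//=.
    rewrite ler_pdivrMr// -mulrA ler_pM2l ?pi_gt0//.
    rewrite mulrC ler_pdivlMr// -natrM ler_nat; lia.
  move=> /(_ isT) /(ler_wpM2l (ltW n0)); apply: le_trans.
  have -> : m.*2.+1%:R * (root_angle m.*2.+1 k.+1 / 2) = pi * k.+1%:R / 2.
    by rewrite /root_angle; field; rewrite gt_eqF.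
  by nra.
have s0 : 0 < sin (root_angle m.*2.+1 k.+1).
  rewrite -(pmulr_rgt0 _ n0); apply: lt_le_trans sb; by rewrite ltr0n.
rewrite /a normc_opp normcM normcV !normcXn csin_real normc_real gtr0_norm//.
rewrite -!exprVn -!exprMn ler_sqr ?nnegrE; last 2 first.
- by rewrite mulr_ge0 ?invr_ge0 ?normc_ge0// ltW.
- by rewrite mulr_ge0 ?invr_ge0 ?addr_ge0 ?normc_ge0.
have -> : nc (csin (w / m.*2.+1%:R)) / sin (root_angle m.*2.+1 k.+1) =
   (m.*2.+1%:R * nc (csin (w / m.*2.+1%:R))) / (m.*2.+1%:R *
     sin (root_angle m.*2.+1 k.+1)).
  by field; rewrite !gt_eqF.
apply: ler_pM => //.
- by rewrite mulr_ge0 ?normc_ge0.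
- by rewrite invr_ge0 mulr_ge0 ?(ltW s0).
- by rewrite lef_pV2 ?posrE ?mulr_gt0.
Qed.

End SineProduct.

(** * The reciprocal Gamma function *)

Section GammaTheory.
Variable R : realType.
Local Notation C := R[i].
Implicit Types (z w : C) (a : R).
Local Notation nc := (@normc R).

Lemma cpowD a z w : cpow a (z + w) = cpow a z * cpow a w.
Proof. by rewrite /cpow mulrDl cexpD. Qed.

Lemma cpow_neq0 a z : cpow a z != 0.
Proof. exact: cexp_neq0. Qed.

Lemma cpow0 a : cpow a (0 : C) = 1.
Proof. by rewrite /cpow mul0r cexp0. Qed.

Lemma cpow1 a : 0 < a -> cpow a (1 : C) = a%:C.
Proof. by move=> a0; rewrite /cpow mul1r cexp_real lnK. Qed.

Lemma cpow_nat a z n : cpow a (n%:R * z) = cpow a z ^+ n.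
Proof. by rewrite /cpow -mulrA cexp_natM. Qed.

Lemma cpowM a b z : 0 < a -> 0 < b -> cpow (a * b) z = cpow a z * cpow b z.
Proof. by move=> a0 b0; rewrite /cpow lnM ?posrE// rmorphD mulrDr cexpD. Qed.

Lemma cpow_real a (x : R) : cpow a x%:C = (expR (x * ln a))%:C.
Proof. by rewrite /cpow -rmorphM cexp_real. Qed.

Lemma cpow1_nat n : (0 < n)%N -> cpow n%:R (1 : C) = n%:R.
Proof. by move=> n0; rewrite cpow1 ?ltr0n// rmorph_nat. Qed.

Lemma natC_neq0_gt0 n : (0 < n)%N -> n%:R != 0 :> C.
Proof. by rewrite pnatr_eq0 lt0n. Qed.

Lemma factC_neq0 n : n`!%:R != 0 :> C.
Proof. by rewrite natC_neq0_gt0 ?fact_gt0. Qed.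

Definition rGamma_seq z n : C :=
  \prod_(0 <= k < n.+1) (z + k%:R) / (n`!%:R * cpow n%:R z).

Lemma Gamma_seqV z n : Gamma_seq z n = (rGamma_seq z n)^-1.
Proof. by rewrite /Gamma_seq /rGamma_seq invf_div big_mkord. Qed.

Definition rGamma_ratio z n : C :=
  (z / n.+1%:R + 1) * cexp (z * (ln (n%:R / n.+1%:R))%:C).

Lemma rGamma_seqS z n : (0 < n)%N ->
  rGamma_seq z n.+1 = rGamma_seq z n * rGamma_ratio z n.
Proof.
move=> n0; rewrite /rGamma_seq big_nat_recr//= /rGamma_ratio.
have np : 0 < n%:R :> R by rewrite ltr0n.
have n1p : 0 < n.+1%:R :> R by rewrite ltr0n.
rewrite ln_div ?posrE// rmorphB mulrBr cexpD cexpN -!/(cpow _ _).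
rewrite factS natrM.
have := factC_neq0 n; have := natC_neq0 R n.
have := cpow_neq0 n%:R z; have := cpow_neq0 n.+1%:R z.
move: (cpow _ _) (cpow _ _) (n`!%:R) (\prod_(_ <= _ < _) _) =>
  p q f P p0 q0 N0 f0.
have N0' : 1 + n%:R != 0 :> C by rewrite addrC natr1.
by field; rewrite ?N0' ?p0 ?q0 ?f0.
Qed.

Lemma ln_ratio_bounds n : (0 < n)%N ->
  - (n%:R : R)^-1 <= ln (n%:R / n.+1%:R : R) <= - n.+1%:R^-1.
Proof.
move=> n0.
have np : 0 < n%:R :> R by rewrite ltr0n.
have n1p : 0 < n.+1%:R :> R by rewrite ltr0n.
apply/andP; split.
- rewrite -[ln _]opprK lerN2 -lnV ?posrE ?divr_gt0// invf_div.
  have -> : n.+1%:R / n%:R = 1 + n%:R^-1 :> R.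
    by rewrite -natr1 mulrDl mulfV ?gt_eqF// mul1r.
  by apply: le_ln1Dx; rewrite (@lt_trans _ _ 0) ?ltrN10 ?invr_gt0.
- have -> : n%:R / n.+1%:R = 1 + - n.+1%:R^-1 :> R.
    by rewrite -natr1; field; rewrite natr1 gt_eqF.
  by apply: le_ln1Dx; rewrite ltrN2 invf_lt1// ltr1n ltnS.
Qed.

(** With [h = 1 / (n + 1)] and [L = ln (n / (n + 1)) = - h + O(h ^ 2)], the
    ratio is [(1 + z h) exp (z L)],
      and the terms of first order in [h] cancel. *)
Lemma rGamma_ratio_le z : exists2 B : R, 0 <= B &
  \forall n \near \oo%classic, nc (rGamma_ratio z n - 1) <= B / n.+1%:R ^+ 2.
Proof.
pose rho := nc z; have rho0 : 0 <= rho := normc_ge0 z.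
exists (2 * rho + 58 * rho ^+ 2).
  by rewrite addr_ge0 ?mulr_ge0 ?sqr_ge0.
apply: filterS (near_leqn (4 * rho)) => n /andP[rn n0].
have np : 0 < n%:R :> R by rewrite ltr0n.
have n1p : 0 < n.+1%:R :> R by rewrite ltr0n.
have /andP[L1 L2] := ln_ratio_bounds n0.
rewrite /rGamma_ratio; set L := ln _ in L1 L2 *.
pose h : R := n.+1%:R^-1; have h0 : 0 < h by rewrite invr_gt0.
have nh : n%:R^-1 <= 2 * h :> R.
  rewrite /h -ler_pdivrMl// -invfM lef_pV2 ?posrE ?mulr_gt0//.
  by rewrite -natrM ler_nat; lia.
have nhh : n%:R^-1 - h <= 2 * h ^+ 2 :> R.
  have -> : n%:R^-1 - h = n%:R^-1 * h :> R.
    by rewrite /h -natr1; field; rewrite natr1 !gt_eqF.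
  by rewrite expr2 mulrA ler_pM2r.
have Lh : `|L + h| <= 2 * h ^+ 2 by rewrite ler_norml; move: L2; rewrite -/h;
  lra.
have La : `|L| <= 2 * h by rewrite ler_norml; move: L2; rewrite -/h; lra.
have rh : rho * h <= 1 / 4.
  rewrite /h ler_pdivrMr//; move: rn;
    have -> : n.+1%:R = n%:R + 1 :> R by rewrite natr1.
  by lra.
pose w := z * L%:C; pose r := cexp w - 1 - w.
have nw : nc w <= 2 * (rho * h).
  by rewrite normcM normc_real -/rho mulrCA ler_wpM2l.
have nr : nc r <= 28 * rho ^+ 2 * h ^+ 2.
  have w0 := normc_ge0 w.
  apply: (@le_trans _ _ (7 * nc w ^+ 2)).
    by apply: normc_cexp_le; apply: le_trans nw _; lra.
  have : nc w ^+ 2 <= (2 * (rho *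
    h)) ^+ 2 by rewrite ler_sqr ?nnegrE ?(le_trans w0).
  by rewrite !exprMn; lra.
have -> : (z / n.+1%:R + 1) * cexp (z * L%:C) - 1 =
    z * (L + h)%:C + (z * h%:C) * w + (1 + z * h%:C) * r.
  have -> : cexp (z * L%:C) = 1 + w + r by rewrite /r -/w; ring.
  rewrite rmorphD /= (_ : n.+1%:R^-1 = h%:C); last first.
    by rewrite /h fmorphV rmorph_nat.
  by rewrite /w; generalize r => r0; ring.
apply: le_trans (normc_triangle _ _) _.
have t1 := normc_triangle (z * (L + h)%:C) (z * h%:C * w).
have nzh : nc (z * h%:C) = rho * h by rewrite normcM normc_real gtr0_norm.
have n1 : nc (z * (L + h)%:C) <= rho * (2 * h ^+ 2).
  by rewrite normcM normc_real ler_wpM2l.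
have n2 : nc (z * h%:C * w) <= (rho * h) * (2 * (rho * h)).
  by rewrite normcM nzh ler_wpM2l// mulr_ge0// ltW.
have n3 : nc ((1 + z * h%:C) * r) <= 2 * (28 * rho ^+ 2 * h ^+ 2).
  rewrite normcM; apply: ler_pM => //; try exact: normc_ge0.
  by apply: le_trans (normc_triangle _ _) _; rewrite normc1 nzh; lra.
rewrite -exprVn -/h.
have e2 : rho * h * (2 * (rho * h)) = 2 * (rho ^+ 2 * h ^+ 2) by ring.
rewrite e2 in n2; lra.
Qed.

Lemma rGamma_seq_split z n m : (0 < n <= m)%N ->
  rGamma_seq z m = rGamma_seq z n * \prod_(n <= k < m) rGamma_ratio z k.
Proof.
move=> /andP[n0]; elim: m => [|m IH]; first by rewrite leqn0 => /eqP n00;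
  rewrite n00 in n0.
rewrite leq_eqVlt => /orP[/eqP <-|]; first by rewrite big_geq// mulr1.
rewrite ltnS => nm; rewrite big_nat_recr//= mulrA -IH// rGamma_seqS//.
exact: leq_trans nm.
Qed.

(** The relative form of the bound, with the earlier approximant as a factor,
    gives both convergence and non-vanishing of the limit. *)
Lemma rGamma_seq_cauchy z : exists2 B : R, 0 <= B & \forall n \near \oo%classic,
  forall m, (n <= m)%N ->
    nc (rGamma_seq z m - rGamma_seq z n) <= nc (rGamma_seq z n) * (B / n%:R).
Proof.
have [B B0 [N _ HN]] := rGamma_ratio_le z.
exists (2 * B); first exact: mulr_ge0.
have nearN : \forall n \near \oo%classic, (N <= n)%N by exists N.
near=> n => m nm.
have /andP[Bn n0] : (2 * B <= n%:R) && (0 < n)%N by near: n; exact: near_leqn.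
rewrite (@rGamma_seq_split z n m) ?n0//.
have -> (x y : C) : x * y - x = x * (y - 1) by ring.
rewrite normcM ler_wpM2l ?normc_ge0//.
under eq_bigr do rewrite -[rGamma_ratio _ _](addrNK 1) addrC.
apply: normc_prod1D_le => //; first by rewrite n0.
move=> k /andP[nk _]; apply: HN => /=; apply: leq_trans nk.
by near: n.
Unshelve. all: by end_near. Qed.

Definition rGamma z : C := seq_lim (rGamma_seq z).

Lemma tends_rGamma z : tends (rGamma_seq z) (rGamma z).
Proof.
suff [l ul] : exists l, tends (rGamma_seq z) l.
  by rewrite /rGamma (tends_lim ul).
have [B B0 [N _ HN]] := rGamma_seq_cauchy z.
have [M _ HM] := near_leqn B.
pose P := maxn N M.
have PN : (N <= P)%N := leq_maxl _ _; have PM : (M <= P)%N := leq_maxr _ _.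
apply: (@cauchy_tends _ _ (2 * nc (rGamma_seq z P) * B) P) => n m /andP[Pn nm].
apply: le_trans (HN n (leq_trans PN Pn) m nm) _.
rewrite mulrA ler_wpM2r ?invr_ge0// ler_wpM2r//.
have := HN P PN n Pn.
have /andP[BP P0] := HM P PM.
have BP1 : B / P%:R <= 1 by rewrite ler_pdivrMr ?mul1r ?ltr0n.
have := normc_triangle (rGamma_seq z n - rGamma_seq z P) (rGamma_seq z P).
rewrite subrK; have := normc_ge0 (rGamma_seq z P).
move: (nc (_ - _)) (nc _) (nc _) => x y t y0 h1 h2; nra.
Qed.

Arguments tends_rGamma z : clear implicits.

Lemma rGamma_seq_pole z : Gamma_pole z ->
  \forall n \near \oo%classic, rGamma_seq z n = 0.
Proof.
move=> [k ->]; exists k => // n /= kn.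
have kn1 : (k < n.+1)%N by [].
rewrite /rGamma_seq (@big_cat_nat _ _ _ k)//= ?(ltnW kn1)//.
by rewrite (big_ltn kn1) addrC subrr mul0r mulr0 mul0r.
Qed.

Lemma rGamma_eq0 z : Gamma_pole z -> rGamma z = 0.
Proof.
move=> /rGamma_seq_pole z0; apply: tends_unique (tends_rGamma z) _.
by apply: tends_near (tends_cst 0); apply: filterS z0 => n ->.
Qed.

(** If the limit vanished, the relative bound would read
    [nc (rGamma_seq z P) <= nc (rGamma_seq z P) / 2] for a large [P], so the
    approximant itself would be 0 and one of its factors [z + k] too. *)
Lemma rGamma_neq0 z : ~ Gamma_pole z -> rGamma z != 0.
Proof.
move=> zp; apply/eqP => z0; apply: zp.
have [B B0 [N _ HN]] := rGamma_seq_cauchy z.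
have [M _ HM] := near_leqn (2 * B).
pose P := maxn N M.
have PN : (N <= P)%N := leq_maxl _ _; have PM : (M <= P)%N := leq_maxr _ _.
have /andP[BP P0] := HM P PM.
have : nc (rGamma z - rGamma_seq z P) <= nc (rGamma_seq z P) * (B / P%:R).
  apply: (tends_leq (tendsD (tends_rGamma z) (tendsN (tends_cst (rGamma_seq z
    P))))
    (tends_cst (rGamma_seq z P))).
  by exists P => // m /= Pm; exact: HN.
rewrite z0 sub0r normc_opp.
have BP1 : B / P%:R <= 1 / 2 by rewrite ler_pdivrMr ?ltr0n//; lra.
have := normc_ge0 (rGamma_seq z P) => h1 h2.
have : nc (rGamma_seq z P) = 0 by apply/eqP; rewrite eq_le h1 andbT; nra.
move=> /eq0_normc/eqP; rewrite mulf_eq0 invr_eq0 mulf_eq0.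
rewrite (negbTE (factC_neq0 _)) (negbTE (cpow_neq0 _ _)) !orbF.
rewrite big_mkord => /prodf_eq0 [k _]; rewrite addr_eq0 => /eqP ->.
by exists k.
Qed.

(** At a pole the approximants of [rGamma], hence by [0^-1 = 0] also those of
    [Gamma], are eventually 0, so the equation holds there too. *)
Lemma GammaE z : Gamma z = (rGamma z)^-1.
Proof.
apply: tends_lim; have [zp|/rGamma_neq0 z0] := pselect (Gamma_pole z).
  rewrite rGamma_eq0// invr0; apply: tends_near (tends_cst 0).
  by apply: filterS (rGamma_seq_pole zp) => n zn; rewrite Gamma_seqV zn invr0.
rewrite (_ : Gamma_seq z = fun n => (rGamma_seq z n)^-1).
  by apply: tendsV => //; exact: tends_rGamma.
by apply: funext => n; rewrite Gamma_seqV.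
Qed.

Lemma tends_addn_divn (c : C) : tends (fun n => (c + n%:R) / n%:R) 1.
Proof.
apply: (tends_le (tends_divn (nc c))).
apply: filterS (near_leqn (0 : R)) => n /andP[_ n0].
rewrite mulrDl mulfV ?natC_neq0_gt0// addrK.
by rewrite normcM normcV normc_nat.
Qed.

Arguments tends_addn_divn c : clear implicits.

Lemma rGamma1 : rGamma 1 = 1.
Proof.
apply: (tends_unique (tends_rGamma 1)).
apply: tends_near (tends_addn_divn 1).
apply: filterS (near_leqn (0 : R)) => n /andP[_ n0].
rewrite /rGamma_seq cpow1_nat//.
have -> : \prod_(0 <= k < n.+1) (1 + k%:R) = (n.+1)`!%:R :> C.
  rewrite fact_prod big_add1 /= natr_prod; apply: eq_bigr => k _.
  by rewrite nat1r.
rewrite factS natrM -nat1r.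
by have := factC_neq0 n => f0; have := natC_neq0_gt0 n0 => nn0; field;
  rewrite f0 nn0.
Qed.

(** Euler's reflection formula for all [z].  The factors [z + k + 1] and
    [1 - z + k] of the two approximants pair up to those of Euler's product; the
    unmatched last factor, divided by [n], tends to 1. *)
Theorem rGamma_reflection z : rGamma z * rGamma (1 - z) = csin (piC * z) / piC.
Proof.
have pi0 : piC != 0 :> C by rewrite eq_complex /= gt_eqF// pi_gt0.
have [->|z0] := eqVneq z 0.
  rewrite rGamma_eq0; last by exists 0; rewrite oppr0.
  by rewrite mul0r mulr0 /csin mulr0 oppr0 subrr !mul0r.
apply: (tends_unique (tendsM (tends_rGamma z) (tends_rGamma (1 - z)))).
have -> : csin (piC * z) / piC = csin (piC * z) / (piC * z) * z * 1.
  generalize (csin (piC * z)); move: pi0; generalize (@piC R) => p p0 s.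
  by field; rewrite z0 p0.
have pz0 : piC * z != 0 by rewrite mulf_neq0.
have lim := tendsM (tendsM (csin_prod pz0) (tends_cst z)) (tends_addn_divn (1 -
  z)).
apply: tends_near lim.
apply: filterS (near_leqn (0 : R)) => n /andP[_ n0].
rewrite /rGamma_seq.
have e k : 1 - (piC * z) ^+ 2 / (piC * k.+1%:R) ^+ 2 =
    (z + k.+1%:R) * ((1 - z + k%:R) / (k.+1%:R * k.+1%:R)).
  have k0 := natC_neq0 R k.
  have -> : 1 - z + k%:R = k.+1%:R - z by rewrite -nat1r; ring.
  move: pi0; generalize (@piC R) => p p0.
  by field; rewrite p0 ?nat1r k0.
under eq_bigr do rewrite e.
rewrite !big_split /= prodfV big_split/=.
have -> : \prod_(0 <= k < n) k.+1%:R = n`!%:R :> C.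
  by rewrite fact_prod big_add1 /= natr_prod.
rewrite [in RHS]big_ltn// big_add1 [X in _ = _ * (X / _)]big_nat_recr//=.
have cn : cpow n%:R z * cpow n%:R (1 - z) = n%:R.
  by rewrite -cpowD addrCA subrr addr0 cpow1_nat.
rewrite addr0.
set P := \prod_(_ <= _ < _) _; set Q := \prod_(_ <= _ < _) _.
have := factC_neq0 n; have := natC_neq0_gt0 n0; rewrite -cn mulf_eq0 negb_or.
move=> /andP[c1 c2] f0.
by field; rewrite c1 c2 f0.
Qed.

Lemma tends_cexp u z : tends u z -> tends (fun n => cexp (u n)) (cexp z).
Proof.
move=> uz; have uRe := tends_Re uz; have uIm := tends_Im uz.
apply: tends_ReIm => /=; apply: tendsM.
- exact: tends_continuous (@continuous_expR _ _) uRe.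
- exact: tends_continuous (@continuous_cos _ _) uIm.
- exact: tends_continuous (@continuous_expR _ _) uRe.
- exact: tends_continuous (@continuous_sin _ _) uIm.
Qed.

End GammaTheory.
Arguments tends_rGamma {R} z.

(** * Duplication formula *)

Section Duplication.
Variable R : realType.
Local Notation C := R[i].
Implicit Types (z w : C) (a : R).
Local Notation nc := (@normc R).
Local Notation iC := (@iC R).

Lemma prod_double z m :
  (\prod_(0 <= k < m) (z / 2%:R + k%:R)) *
    (\prod_(0 <= k < m) ((z + 1) / 2%:R + k%:R))
  * 4%:R ^+ m = \prod_(0 <= k < m.*2) (z + k%:R).
Proof.
elim: m => [|m IH]; first by rewrite !big_nil !mulr1.
have step (P Q a b q : C) :
  (P * a) * (Q * b) * (4%:R * q) = P * Q * q * (2%:R * a) * (2%:R * b) by ring.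
rewrite doubleS !big_nat_recr//= exprS step IH; congr (_ * _ * _).
  by rewrite -muln2 natrM; field.
by rewrite -[m.*2.+1]addn1 natrD -muln2 natrM; field.
Qed.

Definition dup_factor z n : C :=
  (n.*2.+1)`!%:R * cpow n.*2.+1%:R z /
  (4%:R ^+ n.+1 * n`!%:R ^+ 2 * (cpow n%:R (z / 2%:R) *
    cpow n%:R ((z + 1) / 2%:R))).

Lemma rGamma_seq_dup z n :
  rGamma_seq (z / 2%:R) n * rGamma_seq ((z + 1) / 2%:R) n =
  rGamma_seq z n.*2.+1 * dup_factor z n.
Proof.
rewrite /rGamma_seq /dup_factor -[n.*2.+2]/((n.+1).*2) -prod_double.
have f0 := factC_neq0 R n; have f1 := factC_neq0 R n.*2.+1.
have c0 := cpow_neq0 n.*2.+1%:R z.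
have c1 := cpow_neq0 n%:R (z / 2%:R);
  have c2 := cpow_neq0 n%:R ((z + 1) / 2%:R).
have q0 : 4%:R ^+ n.+1 != 0 :> C by rewrite expf_neq0// natC_neq0.
move: (n`!%:R) (n.*2.+1`!%:R) (cpow _ _) (cpow _ _) (cpow _ _) (4%:R ^+ _) f0
  f1 c0 c1 c2 q0.
move: (\prod_(_ <= _ < _) _) (\prod_(_ <= _ < _) _) =>
  P Q f g c d e q f0 f1 c0 c1 c2 q0.
by field; rewrite f0 f1 c0 c1 c2 q0.
Qed.

(** The factorials of [dup_factor] do not depend on [z], so its limit for every
    [z] follows from the one at [z = 1]. *)
Lemma dup_factor_shift z n : (0 < n)%N ->
  dup_factor z n = dup_factor 1 n * cexp ((z - 1) *
    (ln (n.*2.+1%:R / n%:R))%:C).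
Proof.
move=> n0.
rewrite ln_div ?posrE ?ltr0n// rmorphB mulrBr cexpD cexpN -!/(cpow _ _)
  /dup_factor.
have e1 : cpow n.*2.+1%:R z = cpow n.*2.+1%:R 1 * cpow n.*2.+1%:R (z - 1).
  by rewrite -cpowD; congr cpow; ring.
have e2 : cpow n%:R (z / 2%:R) * cpow n%:R ((z + 1) / 2%:R) =
    cpow n%:R (1 / 2%:R) * cpow n%:R ((1 + 1) / 2%:R) * cpow n%:R (z - 1).
  by rewrite -!cpowD; congr cpow; field.
rewrite e1 e2 !invfM; ring.
Qed.

Lemma tends_ratio_ln z :
  tends (fun n => cexp (z * (ln (n.*2.+1%:R / n%:R))%:C)) (cpow (2%:R : R) z).
Proof.
apply: tends_cexp; apply: tendsM; first exact: tends_cst.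
apply: tends_real.
have lim : tends (fun n => 2%:R + 1 / n%:R : R) 2%:R.
  rewrite -[X in tends _ X]addr0; apply: tendsD; first exact: tends_cst.
  exact: tends_divn.
have ln2 := tends_continuous (@continuous_ln R 2%:R (ltr0n _ _)) lim.
apply: tends_near ln2; apply: filterS (near_leqn (0 : R)) => n /andP[_ n0].
congr ln; rewrite -[n.*2.+1]addn1 natrD -muln2 natrM mulrDl mulrAC mulfV
  ?mul1r//.
by rewrite gt_eqF// ltr0n.
Qed.

Arguments tends_ratio_ln z : clear implicits.

(** At [z = 1] the duplication relation has [rGamma 1 = 1] on both sides. *)
Lemma tends_dup_factor : tends (dup_factor (1 : C)) (rGamma (1 / 2%:R)).
Proof.
have odd_ge n : (n <= n.*2.+1)%N by lia.
have h1 := tends_sub odd_ge (tends_rGamma (1 : C)).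
have h2 := tendsV (_ : rGamma (1 : C) != 0) h1.
have h := tendsM (tendsM (tends_rGamma (1 / 2%:R : C)) (tends_rGamma ((1 + 1) /
  2%:R : C))) (h2 _).
have e : (1 + 1) / 2%:R = 1 :> C by field.
rewrite e rGamma1 invr1 !mulr1 in h.
apply: tends_near (h _); last by rewrite oner_eq0.
apply: nearW => n; have := rGamma_seq_dup 1 n; rewrite e => ->;
  rewrite mulrAC mulfV ?mul1r//.
rewrite mulf_neq0 ?invr_eq0 ?mulf_neq0 ?factC_neq0 ?cpow_neq0//.
by rewrite big_mkord; apply/prodf_neq0 => k _; rewrite nat1r natC_neq0.
Qed.

Lemma rGamma_dup_half z : rGamma (z / 2%:R) * rGamma ((z + 1) / 2%:R) =
  rGamma z * (rGamma (1 / 2%:R) * cpow (2%:R : R) (z - 1)).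
Proof.
have odd_ge n : (n <= n.*2.+1)%N by lia.
apply: (tends_unique (tendsM (tends_rGamma (z / 2%:R)) (tends_rGamma ((z + 1) /
  2%:R)))).
have lim := tendsM (tends_sub odd_ge (tends_rGamma z))
  (tendsM tends_dup_factor (tends_ratio_ln (z - 1))).
apply: tends_near lim; apply: filterS (near_leqn (0 : R)) => n /andP[_ n0].
by rewrite rGamma_seq_dup (dup_factor_shift z).
Qed.

(** The value [Gamma (1 / 2) = sqrt pi]: the reflection formula gives its
    square and the sign is that of the approximants. *)
Lemma rGamma_half : rGamma (1 / 2%:R) = cpow (pi : R) (- (1 / 2%:R)).
Proof.
have pi0 : 0 < pi :> R := pi_gt0 R.
have c_real : cpow (pi : R) (- (1 / 2%:R)) = (expR (- (1 / 2%:R) * ln pi))%:C.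
  rewrite -cpow_real; congr cpow.
  by rewrite rmorphN fmorph_div rmorph1 rmorph_nat.
have sq : rGamma (1 / 2%:R : C) ^+ 2 = cpow (pi : R) (- (1 / 2%:R)) ^+ 2.
  have := rGamma_reflection (1 / 2%:R : C).
  have -> : 1 - 1 / 2%:R = 1 / 2%:R :> C by field.
  rewrite expr2 => ->; rewrite -cpow_nat.
  have -> : 2%:R * - (1 / 2%:R) = - 1 :> C by field.
  rewrite /cpow mulN1r cexpN -[X in cexp X]mul1r -/(cpow _ _) cpow1//.
  rewrite [X in csin X](_ : _ = (pi / 2%:R)%:C); last first.
    by rewrite /piC mul1r fmorph_div rmorph_nat.
  by rewrite csin_real sin_pihalf mul1r.
have Re_ge0 : 0 <= complex.Re (rGamma (1 / 2%:R : C)).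
  apply: (ler_cvg_to (tends_cst 0) (tends_Re (tends_rGamma (1 / 2%:R : C)))).
  apply: nearW => n.
  suff : 0 <= rGamma_seq (1 / 2%:R : C) n by rewrite lecE => /andP[_].
  rewrite /rGamma_seq divr_ge0//.
    by apply: prodr_ge0 => k _; rewrite addr_ge0// divr_ge0.
  have -> : 1 / 2%:R = (1 / 2%:R : R)%:C :> C by rewrite fmorph_div rmorph1
    rmorph_nat.
  by rewrite cpow_real mulr_ge0// lecR expR_ge0.
have /eqP := sq; rewrite eqf_sqr => /orP[/eqP//|/eqP rE].
move: Re_ge0; rewrite rE c_real /= oppr_ge0.
by rewrite leNgt expR_gt0.
Qed.

Lemma rGamma_duplication z : rGamma (z / 2%:R) * rGamma ((z + 1) / 2%:R) =
  cpow (pi : R) (- (1 / 2%:R)) * cpow (2%:R : R) (z - 1) * rGamma z.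
Proof. by rewrite rGamma_dup_half rGamma_half mulrC. Qed.

(** The trigonometric factor that belongs to the parity [d] in [Gsym]. *)
Definition ctrig (d : nat) z : C := if d is 0%N then ccos z else csin z.

Lemma rGamma_half_neq0 (d : nat) z : ~ Gamma_pole z -> rGamma ((d%:R + z) /
  2%:R) != 0.
Proof.
move=> zp; apply: rGamma_neq0 => -[n h]; apply: zp; exists (n.*2 + d)%N.
have -> : z = (d%:R + z) / 2%:R * 2%:R - d%:R by field.
by rewrite h natrD -muln2 natrM; ring.
Qed.

(** Reflection at [(d' + z) / 2], with [d'] the other parity, expresses the
    trigonometric function through [rGamma ((d' + z) / 2)], which duplication
    replaces by [rGamma z / rGamma ((d + z) / 2)].  As [z] is not a pole, both
    reciprocals that appear are nonzero. *)
Theorem Gamma_half_ratio (d : nat) z : (d < 2)%N -> ~ Gamma_pole z ->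
  Gamma ((d%:R + z) / 2%:R) / Gamma ((1 + d%:R - z) / 2%:R) =
  Gamma z * ctrig d (piC * z / 2%:R) *
  (cpow (2%:R : R) (1 - z) * cpow (pi : R) (- (1 / 2%:R))).
Proof.
move=> d2 zp; rewrite !GammaE invrK.
have z0 := rGamma_neq0 zp.
have dup := rGamma_duplication z.
have h0 := rGamma_half_neq0 0 zp; have h1 := rGamma_half_neq0 1 zp.
have p0 : piC != 0 :> C by rewrite eq_complex /= gt_eqF// pi_gt0.
have c1 : cpow (2%:R : R) (1 - z) * cpow (2%:R : R) (z - 1) = 1.
  by rewrite -cpowD [1 - z + _](_ : _ = 0) ?cpow0//; ring.
have cp : cpow (pi : R) (- (1 / 2%:R)) ^+ 2 * piC = 1.
  rewrite -cpow_nat.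
  rewrite [2%:R * _](_ : _ = -1); last by field.
  by rewrite -[piC](@cpow1 R pi (pi_gt0 R)) -cpowD addNr cpow0.
have r0 := rGamma_reflection (z / 2%:R).
have r1 := rGamma_reflection ((z + 1) / 2%:R).
rewrite mulrA in r0.
have tE : csin (piC * ((z + 1) / 2%:R)) = ccos (piC * z / 2%:R).
  by rewrite -csinDpihalf; congr csin; field.
rewrite tE in r1.
have a0 : (0%:R + z) / 2%:R = z / 2%:R by rewrite add0r.
have a1 : (1%:R + z) / 2%:R = (z + 1) / 2%:R by rewrite addrC.
rewrite a0 in h0; rewrite a1 in h1.
have {r0} r0 := canLR (mulfVK p0) r0; have {r1}r1 := canLR (mulfVK p0) r1.
have half_alg (A B E p t : C) : A != 0 -> A * B = p * t * rGamma z ->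
    p ^+ 2 * piC = 1 -> cpow (2%:R : R) (1 - z) * t = 1 ->
    A^-1 * E = (rGamma z)^-1 * (B * E * piC) * (cpow (2%:R : R) (1 - z) * p).
  move=> A0 AB pp tt; apply: (mulfI A0); rewrite mulrA mulfV// mul1r.
  transitivity ((rGamma z)^-1 * (A * B) * E * piC * (cpow (2%:R : R) (1 - z) *
    p)); last by ring.
  rewrite AB; transitivity ((rGamma z)^-1 * rGamma z *
    (cpow (2%:R : R) (1 - z) * t) * (p ^+ 2 * piC) * E); last by ring.
  by rewrite mulVf// tt pp !mul1r.
case: d d2 => [|[|//]] _ /=.
- rewrite a0 addr0 -r1.
  have -> : 1 - (z + 1) / 2%:R = (1 - z) / 2%:R by field.
  exact: half_alg dup cp c1.
- rewrite a1 -r0.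
  have -> : (1 + 1 - z) / 2%:R = 1 - z / 2%:R by field.
  by apply: half_alg cp c1 => //; rewrite mulrC.
Qed.

End Duplication.

(** * Comparison of the two kernels *)

Section Final.
Variable R : realType.
Local Notation C := R[i].
Local Notation iC := (@iC R).

Lemma cexp_euler (z : C) : cexp (iC * z) = ccos z + iC * csin z.
Proof.
rewrite /ccos /csin.
move: (cexp _) (cexp _) => a b; field; exact: iC_neq0.
Qed.

Lemma ccosN (z : C) : ccos (- z) = ccos z.
Proof. by rewrite /ccos !mulrN opprK addrC. Qed.

Lemma sum_parity_constraint (V : nmodType) (F : nat -> nat -> nat -> V) :
  \sum_(d1 < 2) \sum_(d2 < 2) \sum_(d3 < 2 | (d3 == d1 + d2 %[mod 2])%N) F d1
    d2 d3
  = F 0%N 0%N 0%N + F 0%N 1%N 1%N + (F 1%N 0%N 1%N + F 1%N 1%N 0%N).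
Proof.
under eq_bigr do under eq_bigr do rewrite big_mkcond.
by rewrite !big_ord_recl !big_ord0 /= !addr0 !add0r.
Qed.

(** The shifts [mu] cancel in the powers of 2 because [s1 + mu] and [s2 - mu]
    have sum [s1 + s2]. *)
Lemma prod_half_ratio (d1 d2 : nat) (mu : 'rV[C]_3) (s1 s2 : C) :
  (d1 < 2)%N -> (d2 < 2)%N ->
  (forall j : 'I_3, ~ Gamma_pole (s1 + mu 0 j)) ->
  (forall j : 'I_3, ~ Gamma_pole (s2 - mu 0 j)) ->
  \prod_(k < 3)
    (Gamma ((d1%:R + s1 - (- mu) 0 k) / 2%:R)
     * Gamma ((d2%:R + s2 + (- mu) 0 k) / 2%:R)
     / (Gamma ((1 + d1%:R - s1 + (- mu) 0 k) / 2%:R)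
        * Gamma ((1 + d2%:R - s2 - (- mu) 0 k) / 2%:R))) =
  (\prod_(k < 3) Gamma (s1 + mu 0 k)) *
    (\prod_(k < 3) Gamma (s2 + (- mu) 0 k)) *
  ((\prod_(k < 3) ctrig d1 (piC * (s1 + mu 0 k) / 2%:R)) *
   (\prod_(k < 3) ctrig d2 (piC * (s2 + (- mu) 0 k) / 2%:R))) *
  (cpow (2%:R : R) (2%:R - s1 - s2) * cpow (pi : R) (- (1 / 2%:R)) ^+ 2) ^+ 3.
Proof.
move=> d12 d22 p1 p2.
rewrite -[X in _ = _ * (_ ^+ X)](card_ord 3) -prodr_const -!big_split/=.
apply: eq_bigr => k _; rewrite !mxE opprK.
rewrite -mulf_div.
have -> : d1%:R + s1 + mu 0 k = d1%:R + (s1 + mu 0 k) by ring.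
have -> : d2%:R + s2 - mu 0 k = d2%:R + (s2 - mu 0 k) by ring.
have -> : 1 + d1%:R - s1 - mu 0 k = 1 + d1%:R - (s1 + mu 0 k) by ring.
have -> : 1 + d2%:R - s2 + mu 0 k = 1 + d2%:R - (s2 - mu 0 k) by ring.
rewrite (Gamma_half_ratio d12 (p1 k)) (Gamma_half_ratio d22 (p2 k)).
have -> : 2%:R - s1 - s2 = (1 - (s1 + mu 0 k)) + (1 - (s2 - mu 0 k)) by ring.
rewrite [in RHS]cpowD; ring.
Qed.

(** Seven quotients of Gammas each contribute [pi ^ (- 1 / 2)]; the factor [32]
    is the [16] of two [calG] times the [2] of the sum over signs. *)
Lemma calG_Gsym_constant (s1 s2 : C) :
  512%:R * cpow (pi : R) (3%:R * (2%:R - s1 - s2)) *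
    cpow (2%:R : R) (- s1 - s2) *
  ((1024%:R * cpow (pi : R) (5%:R / 2%:R))^-1 *
   ((cpow (2%:R : R) (s1 + s2) * cpow (pi : R) (- (1 / 2%:R))) *
    (cpow (2%:R : R) (2%:R - s1 - s2) *
      cpow (pi : R) (- (1 / 2%:R)) ^+ 2) ^+ 3)) =
  32%:R * (cpow (2%:R * pi : R) (- (3%:R * s1)) * cpow (2%:R *
    pi : R) (- (3%:R * s2))).
Proof.
rewrite -cpowD cpowM ?pi_gt0//.
have two : cpow (2%:R : R) (- s1 - s2) * (cpow (2%:R : R) (s1 + s2) *
    cpow (2%:R : R) (2%:R - s1 - s2) ^+ 3) =
    64%:R * cpow (2%:R : R) (- (3%:R * s1) - 3%:R * s2).
  have -> : 64%:R = cpow (2%:R : R) (6%:R * 1) :> C.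
    by rewrite cpow_nat cpow1// rmorph_nat -natrX.
  by rewrite -cpow_nat -!cpowD; congr cpow; ring.
have pis : cpow (pi : R) (3%:R * (2%:R - s1 - s2)) *
   (cpow (pi : R) (- (1 / 2%:R)) * (cpow (pi : R) (- (1 / 2%:R)) ^+ 2) ^+ 3) =
   cpow (pi : R) (- (3%:R * s1) - 3%:R * s2) * cpow (pi : R) (5%:R / 2%:R).
  by rewrite -!cpow_nat -!cpowD; congr cpow; field.
have p5 := cpow_neq0 (pi : R) (5%:R / 2%:R).
rewrite exprMn.
move: two pis p5.
move: (cpow 2%:R (- s1 - s2)) (cpow 2%:R (s1 + s2)) (cpow 2%:R _ ^+ 3) => a b c.
move: (cpow 2%:R _) => d.
move: (cpow pi (3%:R * _)) (cpow pi (- (1 / 2%:R))) ((_ ^+ 2) ^+ 3) => e f g.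
move: (cpow pi (_ / _)) (cpow pi _) => h k two pis p5.
transitivity (512%:R / 1024%:R * (a * (b * c)) * (e * (f * g)) / h).
  by field.
by rewrite two pis; field.
Qed.

Lemma calG_mulE (mu nu : 'rV[C]_3) (s1 s2 : C) (eta1 eta2 : int) :
  calG eta1 mu s1 * calG eta2 nu s2 =
  16%:R * (cpow (2%:R * pi) (- (3%:R * s1)) * cpow (2%:R * pi) (- (3%:R *
    s2))) *
  ((\prod_(k < 3) Gamma (s1 + mu 0 k)) * (\prod_(k < 3) Gamma (s2 + nu 0 k))) *
  ((\prod_(k < 3) ctrig 0 (piC * (s1 + mu 0 k) / 2%:R)
    + eta1%:~R * (iC^-1 * \prod_(k < 3) ctrig 1 (piC * (s1 + mu 0 k) / 2%:R))) *
   (\prod_(k < 3) ctrig 0 (piC * (s2 + nu 0 k) / 2%:R)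
    + eta2%:~R * (iC^-1 * \prod_(k < 3) ctrig 1 (piC * (s2 + nu 0 k) / 2%:R)))).
Proof. rewrite /calG /=; ring. Qed.

End Final.

Theorem lemma2p3 (R : realType) (e1 e2 : int) (mu0 : 'rV[R[i]]_3)
    (s1 s2 : R[i])
    (he1 : e1 \in [:: 1; -1]) (he2 : e2 \in [:: 1; -1])
    (mu0_imaginary : forall j : 'I_3, complex.Re (mu0 0 j) = 0)
    (mu0_sum : \sum_(j < 3) mu0 0 j = 0)
    (s_regular : ~ polar mu0 s1 s2) :
  Gmu e1 e2 mu0 s1 s2 =
  512%:R * cpow pi (3%:R * (2%:R - s1 - s2)) * cpow 2%:R (- s1 - s2)
  * Gsym (- e2) (- e1) s1 s2 (- mu0).
Proof.
have p0 : ~ Gamma_pole (1 - s1 - s2) by move=> h; apply: s_regular;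
  constructor 1.
have p1 j : ~ Gamma_pole (s1 + mu0 0 j).
  by move=> h; apply: s_regular; constructor 2; exists j.
have p2 j : ~ Gamma_pole (s2 - mu0 0 j).
  by move=> h; apply: s_regular; constructor 3; exists j.
pose C1 := \prod_(k < 3) ctrig 0 (piC * (s1 + mu0 0 k) / 2%:R).
pose S1 := \prod_(k < 3) ctrig 1 (piC * (s1 + mu0 0 k) / 2%:R).
pose C2 := \prod_(k < 3) ctrig 0 (piC * (s2 + (- mu0) 0 k) / 2%:R).
pose S2 := \prod_(k < 3) ctrig 1 (piC * (s2 + (- mu0) 0 k) / 2%:R).
pose phi : R[i] := piC * (1 - s1 - s2) / 2%:R.
pose G := Gamma (1 - s1 - s2) * ((\prod_(k < 3) Gamma (s1 + mu0 0 k)) *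
  (\prod_(k < 3) Gamma (s2 + (- mu0) 0 k))).
pose K := cpow (2%:R * pi : R) (- (3%:R * s1)) * cpow (2%:R *
  pi : R) (- (3%:R * s2)).
(* The powers of 2 and pi contributed by the half-argument quotients. *)
pose kappa := (cpow (2%:R : R) (s1 + s2) * cpow (pi : R) (- (1 / 2%:R))) *
  (cpow (2%:R : R) (2%:R - s1 - s2) * cpow (pi : R) (- (1 / 2%:R)) ^+ 2) ^+ 3.
pose T d1 d2 d3 : R[i] := (- e2)%:~R ^+ d1 * (- e1)%:~R ^+ d2 * (-1) ^+ (d1 *
  d2) *
  (ctrig d3 phi * ((if d1 is 0%N then C1 else S1) *
    (if d2 is 0%N then C2 else S2))).
have GsymE : Gsym (- e2) (- e1) s1 s2 (- mu0) =
    (1024%:R * cpow (pi : R) (5%:R / 2%:R))^-1 * kappa *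
    (G * (T 0%N 0%N 0%N + T 0%N 1%N 1%N + (T 1%N 0%N 1%N + T 1%N 1%N 0%N))).
  rewrite /Gsym -mulrA; congr (_ * _).
  transitivity (\sum_(d1 < 2) \sum_(d2 < 2) \sum_(d3 < 2 | (d3 == d1 + d2 %[mod
    2])%N)
      kappa * (G * T d1 d2 d3)).
    apply: eq_bigr => d1 _; apply: eq_bigr => d2 _; apply: eq_bigr => d3 _.
    rewrite (prod_half_ratio (ltn_ord d1) (ltn_ord d2) p1 p2).
    have -> : 1 + d3%:R - s1 - s2 = d3%:R + (1 - s1 - s2) by ring.
    have -> : d3%:R + s1 + s2 = 1 + d3%:R - (1 - s1 - s2) by ring.
    rewrite (Gamma_half_ratio (ltn_ord d3) p0).
    have -> : 1 - (1 - s1 - s2) = s1 + s2 by ring.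
    rewrite /T /G /kappa -/phi.
    have -> : \prod_(k < 3) ctrig d1 (piC * (s1 + mu0 0 k) / 2%:R) =
        (if nat_of_ord d1 is 0%N then C1 else S1).
      by rewrite /C1 /S1; case: d1 => -[|[|]].
    have -> : \prod_(k < 3) ctrig d2 (piC * (s2 + (- mu0) 0 k) / 2%:R) =
        (if nat_of_ord d2 is 0%N then C2 else S2).
      by rewrite /C2 /S2; case: d2 => -[|[|]].
    ring.
  rewrite (sum_parity_constraint (fun d1 d2 d3 => kappa * (G * T d1 d2 d3))).
  by clearbody T G kappa; ring.
have GmuE : Gmu e1 e2 mu0 s1 s2 = 16%:R * K * (G *
    \sum_(eta1 <- [:: 1; -1 : int])
     \sum_(eta2 <- [:: 1; -1 : int] | eta1 * eta2 == e1 * e2)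
      ((ccos phi - iC * (e2%:~R * eta1%:~R * csin phi)) *
       ((C1 + eta1%:~R * (iC^-1 * S1)) * (C2 + eta2%:~R * (iC^-1 * S2))))).
  rewrite /Gmu mulrA mulr_sumr; apply: eq_big_seq => eta1 eta1E.
  rewrite mulr_sumr; apply: eq_bigr => eta2 _.
  rewrite -[LHS]mulrA calG_mulE -/C1 -/C2 -/S1 -/S2 -/K.
  (* Cosine and sine being even and odd, the signs [e2] and [eta1] come out. *)
  have -> : cexp (piC * iC / 2%:R * e2%:~R * eta1%:~R * (s1 + s2 - 1)) =
     ccos phi - iC * (e2%:~R * eta1%:~R * csin phi).
    have -> : piC * iC / 2%:R * e2%:~R * eta1%:~R * (s1 + s2 - 1) =
       iC * (- (e2%:~R * eta1%:~R * phi)) by rewrite /phi; ring.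
    rewrite cexp_euler ccosN csinN mulrN; congr (_ - iC * _).
      by move: he2 eta1E; rewrite !inE => /orP[] /eqP -> /orP[] /eqP ->;
         rewrite ?mulrN1z ?mulr1z ?mulrN ?mulr1 ?mul1r ?mulN1r ?opprK ?mul1r
           ?ccosN.
    by move: he2 eta1E; rewrite !inE => /orP[] /eqP -> /orP[] /eqP ->;
         rewrite ?mulrN1z ?mulr1z ?mulrN ?mulr1 ?mul1r ?mulN1r ?opprK ?mul1r
           ?csinN ?mulN1r.
  rewrite /G; ring.
rewrite GmuE GsymE.
rewrite [RHS]mulrA calG_Gsym_constant -/K /T /=.
have I2 := iC2 R; rewrite iCV.
move: (ccos phi) (csin phi) => c s.
move: iC I2 => I I2.
move: he1 he2; rewrite !inE => /orP[] /eqP -> /orP[] /eqP ->;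
  rewrite !big_cons !big_nil /= ?mulrN1z ?mulr1z ?opprK ?expr0 ?expr1 ?mulr1
    ?mul1r; ring: I2.
Qed.
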